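(* Let $k\in\mathbb{C}\setminus\{0\}$. For $n\in\mathbb{C}$ and $e\in\mathbb{C}$ with $e/k\notin\mathbb{Z}$, the typical irreducible module $\widehat{V}^k_{n,e}$ is projective in $\mathcal{O}_k^{fin}$.
   Context: **Algebra.** $\mathfrak{gl}(1|1)$ has even basis $N,E$ and odd basis $\psi^+,\psi^-$; nonzero brackets $[N,\psi^\pm]=\pm\psi^\pm$, $\{\psi^+,\psi^-\}=E$; invariant form $\kappa(N,E)=\kappa(E,N)=1$, $\kappa(\psi^+,\psi^-)=-\kappa(\psi^-,\psi^+)=1$, zero on other pairs of basis elements. $\widehat{\mathfrak{gl}(1|1)}=\mathfrak{gl}(1|1)\otimes\mathbb{C}[t,t^{-1}]\oplus\mathbb{C}\mathbf{k}$ with $\mathbf k$ central, $[a_r,b_s]=[a,b]_{r+s}+r\kappa(a,b)\delta_{r+s,0}\mathbf{k}$, $a_r=a\otimes t^r$. $V_k(\mathfrak{gl}(1|1))$ is the level-$k$ module induced from the trivial $\mathfrak{gl}(1|1)$-module, a vertex operator superalgebra with conformal vector $\omega=\frac{1}{2k}(N_{-1}E_{-1}+E_{-1}N_{-1}-\psi^+_{-1}\psi^-_{-1}+\psi^-_{-1}\psi^+_{-1})\mathbf 1+\frac{1}{2k^2}E_{-1}^2\mathbf 1$; $L_n$ are the Virasoro modes. **Category.** $\mathcal{O}_k^{fin}$ is the supercategory of finite-length grading-restricted generalized $V_k(\mathfrak{gl}(1|1))$-modules (direct sums of finite-dimensional generalized $L_0$-eigenspaces, lower-bounded in each coset of $\mathbb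 Z$) on which $N_0,E_0$ act semisimply. Modules are $\mathbb Z_2$-graded; morphisms may be even or odd. **Modules.** $V_{n,e}$ is the 2-dimensional Verma $\mathfrak{gl}(1|1)$-module with highest-weight vector $v$: $Nv=(n+\frac12)v$, $Ev=ev$, $\psi^+v=0$. $\widehat V^k_{n,e}$ is the level-$k$ $\widehat{\mathfrak{gl}(1|1)}$-module induced from $V_{n,e}$ (with $a_r$, $r>0$, acting by $0$ on $V_{n,e}$, $a_0$ acting as $a$, $\mathbf k$ acting by $k$); it is irreducible iff $e/k\notin\mathbb{Z}$. *)

(* Defs.v *)
From HB Require Import structures.
From mathcomp Require Import all_boot all_order all_algebra.
From mathcomp Require Import reals complex.
From mathcomp Require Import ring.

Set Implicit Arguments.
Unset Strict Implicit.
Unset Printing Implicit Defensive.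

Import Order.TTheory GRing.Theory Num.Theory.
Local Open Scope ring_scope.

(* [homog M false] and [homog M true] are the even and the odd part of [M];
   here and below parities are booleans ([true] = odd), added by [(+)]. *)
Record superspace (F : numFieldType) : Type := Superspace {
  ss_sort :> lmodType F;
  homog : bool -> ss_sort -> Prop;
  homog_lin : forall (q : bool) (a : F) (x y : ss_sort),
    homog q x -> homog q y -> homog q (a *: x + y);
  homog_direct : forall x : ss_sort, homog false x -> homog true x -> x = 0;
  homog_sum : forall x : ss_sort,
    exists y z : ss_sort, [/\ homog false y, homog true z & x = y + z] }.

Definition is_linear (F : numFieldType) (M N : lmodType F) (f : M -> N) : Prop :=
  forall (a : F) (x y : M), f (a *: x + y) = a *: f x + f y.

Definition has_parity (F : numFieldType) (M N : superspace F) (p : bool)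
    (f : M -> N) : Prop :=
  forall (q : bool) (x : M), homog q x -> homog (p (+) q) (f x).

(* For a linear subspace [P] this is finite-dimensionality of [P]. *)
Definition finite_dim (F : numFieldType) (M : lmodType F) (P : M -> Prop) : Prop :=
  exists s : seq M, forall x, P x ->
    exists c : nat -> F, x = \sum_(i < size s) c i *: s`_i.

Definition eigenvector (F : numFieldType) (M : lmodType F) (T : M -> M)
    (h : F) (x : M) : Prop :=
  T x = h *: x.

Definition gen_eigenvector (F : numFieldType) (M : lmodType F) (T : M -> M)
    (h : F) (x : M) : Prop :=
  exists n : nat, iter n (fun y => T y - h *: y) x = 0.

(* [M] is the sum of the subspaces [P h].  For the (generalized) eigenspaces
   of a linear operator such a sum is automatically direct. *)
Definition spanned_by_family (F : numFieldType) (M : lmodType F)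
    (P : F -> M -> Prop) : Prop :=
  forall x : M, exists s : seq (F * M),
    (forall u, List.In u s -> P u.1 u.2) /\ x = \sum_(u <- s) u.2.

Definition semisimple_op (F : numFieldType) (M : lmodType F) (T : M -> M) : Prop :=
  spanned_by_family (eigenvector T).

Inductive gl11 : Type := gN | gE | psi_p | psi_m.

Definition gl_par (a : gl11) : bool :=
  match a with gN | gE => false | psi_p | psi_m => true end.

(* [gl_br a b c] is the coefficient of [c] in the superbracket [a, b]. *)
Definition gl_br (F : numFieldType) (a b c : gl11) : F :=
  match a, b, c with
  | gN, psi_p, psi_p => 1
  | psi_p, gN, psi_p => -1
  | gN, psi_m, psi_m => -1
  | psi_m, gN, psi_m => 1
  | psi_p, psi_m, gE => 1
  | psi_m, psi_p, gE => 1
  | _, _, _ => 0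
  end.

Definition gl_kappa (F : numFieldType) (a b : gl11) : F :=
  match a, b with
  | gN, gE | gE, gN => 1
  | psi_p, psi_m => 1
  | psi_m, psi_p => -1
  | _, _ => 0
  end.

Definition gl_comb (F : numFieldType) (M : lmodType F) (c : gl11 -> F)
    (f : gl11 -> M) : M :=
  c gN *: f gN + c gE *: f gE + c psi_p *: f psi_p + c psi_m *: f psi_m.

Definition is_gl11_module (F : numFieldType) (U : superspace F)
    (act : gl11 -> U -> U) : Prop :=
  [/\ forall a, is_linear (act a),
      forall a, has_parity (gl_par a) (act a)
    & forall a b (u : U),
        act a (act b u) - (-1) ^+ (gl_par a && gl_par b) *: act b (act a u)
        = gl_comb (gl_br F a b) (fun c => act c u)].

(* [act a r] is the action of a_r; the central element acts by [k]. *)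
Definition is_affine_module (F : numFieldType) (k : F) (M : superspace F)
    (act : gl11 -> int -> M -> M) : Prop :=
  [/\ forall a r, is_linear (act a r),
      forall a r, has_parity (gl_par a) (act a r)
    & forall a b (r s : int) (x : M),
        act a r (act b s x)
          - (-1) ^+ (gl_par a && gl_par b) *: act b s (act a r x)
        = gl_comb (gl_br F a b) (fun c => act c (r + s) x)
          + (r%:~R * gl_kappa F a b * (r + s == 0)%:R * k) *: x].

(* An even linear map from [U] intertwining the action of gl(1|1)[t], where
   the a_r with r > 0 act by zero on [U]. *)
Definition is_top_map (F : numFieldType) (U M : superspace F)
    (gact : gl11 -> U -> U) (act : gl11 -> int -> M -> M) (j : U -> M) : Prop :=
  [/\ is_linear j, has_parity false j,
      forall a u, act a 0 (j u) = j (gact a u)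
    & forall a (r : int) u, 0 < r -> act a r (j u) = 0].

Definition is_affine_hom (F : numFieldType) (M N : superspace F)
    (actM : gl11 -> int -> M -> M) (actN : gl11 -> int -> N -> N)
    (f : M -> N) : Prop :=
  [/\ is_linear f, has_parity false f
    & forall a r x, f (actM a r x) = actN a r (f x)].

(* [(M, act)], together with [j : U -> M], is the level-[k] module induced
   from the gl(1|1)-module [U], expressed by the universal property of
   induction. *)
Definition is_induced (F : numFieldType) (k : F) (U M : superspace F)
    (gact : gl11 -> U -> U) (act : gl11 -> int -> M -> M) (j : U -> M) : Prop :=
  [/\ is_affine_module k act,
      is_top_map gact act j
    & forall (X : superspace F) (actX : gl11 -> int -> X -> X) (phi : U -> X),
        is_affine_module k actX -> is_top_map gact actX phi ->
        exists h : M -> X,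
          [/\ is_affine_hom act actX h,
              forall u, h (j u) = phi u
            & forall h' : M -> X, is_affine_hom act actX h' ->
                (forall u, h' (j u) = phi u) -> forall x, h' x = h x]].

Definition triv_homog (F : numFieldType) (q : bool) (x : F^o) : Prop :=
  if q then x = 0 else True.

Lemma triv_homog_lin (F : numFieldType) (q : bool) (a : F) (x y : F^o) :
  triv_homog q x -> triv_homog q y -> triv_homog q (a *: x + y).
Proof. by case: q => //= -> ->; rewrite scaler0 addr0. Qed.

Lemma triv_homog_direct (F : numFieldType) (x : F^o) :
  triv_homog false x -> triv_homog true x -> x = 0.
Proof. by []. Qed.

Lemma triv_homog_sum (F : numFieldType) (x : F^o) :
  exists y z : F^o, [/\ triv_homog false y, triv_homog true z & x = y + z].
Proof. by exists x, 0; rewrite addr0. Qed.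

Definition triv_space (F : numFieldType) : superspace F :=
  Superspace (@triv_homog_lin F) (@triv_homog_direct F) (@triv_homog_sum F).

Definition triv_act (F : numFieldType) (a : gl11) (x : triv_space F) :
    triv_space F := 0.

(* V_{n,e} has basis v = (1, 0), psi^- v = (0, 1); v has parity [p]. *)
Definition verma_homog (F : numFieldType) (p q : bool) (x : (F^o * F^o)%type) :
    Prop :=
  if q == p then x.2 = 0 else x.1 = 0.

Lemma verma_homog_lin (F : numFieldType) (p q : bool) (a : F)
    (x y : (F^o * F^o)%type) :
  verma_homog p q x -> verma_homog p q y -> verma_homog p q (a *: x + y).
Proof.
case: x y => [x1 x2] [y1 y2]; rewrite /verma_homog.
by case: ifP => _ /= -> ->; rewrite scaler0 addr0.
Qed.

Lemma verma_homog_direct (F : numFieldType) (p : bool) (x : (F^o * F^o)%type) :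
  verma_homog p false x -> verma_homog p true x -> x = 0.
Proof. by case: x p => [x y] []; rewrite /verma_homog /= => -> ->. Qed.

Lemma verma_homog_sum (F : numFieldType) (p : bool) (x : (F^o * F^o)%type) :
  exists y z : (F^o * F^o)%type,
    [/\ verma_homog p false y, verma_homog p true z & x = y + z].
Proof.
case: x p => [x y] [].
  exists (0, y), (x, 0); split => //.
  by rewrite /GRing.add /= /add_pair /= add0r addr0.
exists (x, 0), (0, y); split => //.
by rewrite /GRing.add /= /add_pair /= add0r addr0.
Qed.

Definition verma_space (F : numFieldType) (p : bool) : superspace F :=
  Superspace (@verma_homog_lin F p) (@verma_homog_direct F p)
             (@verma_homog_sum F p).

Definition verma_act (F : numFieldType) (p : bool) (n e : F) (a : gl11)
    (x : verma_space F p) : verma_space F p :=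
  match a with
  | gN => ((n + 2%:R^-1) * x.1, (n - 2%:R^-1) * x.2)
  | gE => (e * x.1, e * x.2)
  | psi_p => (e * x.2, 0)
  | psi_m => (0, x.1)
  end.

Lemma triv_is_gl11_module (F : numFieldType) : is_gl11_module (@triv_act F).
Proof.
split=> [a c x y|a q x _|a b u]; rewrite /triv_act ?scaler0 ?addr0 //.
  by case: (_ (+) _).
by rewrite /gl_comb !scaler0 !addr0 subr0.
Qed.

Lemma verma_is_gl11_module (F : numFieldType) (p : bool) (n e : F) :
  is_gl11_module (@verma_act F p n e).
Proof.
have pairE (a b c d : F) : a = c -> b = d -> (a, b) = (c, d) by move=> -> ->.
split=> [[] c [x1 x2] [y1 y2]|a q [x1 x2]|[] [] [u1 u2]];
  rewrite ?/verma_act ?/gl_comb ?/gl_br /=;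
  try by apply: pairE; rewrite /= /GRing.scale /=; field.
- by case: a q p => [] [] [] /=; rewrite /verma_homog /= => h;
    rewrite ?h ?mulr0.
Qed.

(* For a vertex operator, [Y v n] is the mode v_n : Y(v,z) = sum_n v_n z^(-n-1). *)

Definition gbin (F : numFieldType) (m : int) (j : nat) : F :=
  (\prod_(i < j) (m%:~R - (i : nat)%:R)) / (j`!)%:R.

Definition vertex_operator_map (F : numFieldType) (V W : superspace F)
    (Y : V -> int -> W -> W) : Prop :=
  [/\ forall v n, is_linear (Y v n),
      forall n w, is_linear (fun v => Y v n w),
      forall q v n, homog q v -> has_parity q (Y v n)
    & forall v w, exists N : int, forall n, N <= n -> Y v n w = 0].

(* The Jacobi identity, in components.  Both sums are finite because of the
   truncation condition, so they are compared as eventually constant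
   sequences of partial sums. *)
Definition jacobi_identity (F : numFieldType) (V W : superspace F)
    (YV : V -> int -> V -> V) (YW : V -> int -> W -> W) : Prop :=
  forall (p q : bool) (u v : V) (w : W) (l m n : int),
    homog p u -> homog q v ->
    exists J0 : nat, forall J : nat, (J0 <= J)%N ->
      \sum_(j < J) gbin F m j *: YW (YV u (n + j%:Z) v) (m + l - j%:Z) w
      = \sum_(j < J) ((-1) ^+ j * gbin F n j) *:
          (YW u (m + n - j%:Z) (YW v (l + j%:Z) w)
           - ((-1) ^ n * (-1) ^+ (p && q)) *:
               YW v (n + l - j%:Z) (YW u (m + j%:Z) w)).

(* [vir Y om n] is the Virasoro mode L_n = om_(n+1). *)
Definition vir (F : numFieldType) (V W : superspace F)
    (Y : V -> int -> W -> W) (om : V) (n : int) : W -> W := Y om (n + 1).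

Record vosa (F : numFieldType) : Type := Vosa {
  vosa_space :> superspace F;
  vosa_Y : vosa_space -> int -> vosa_space -> vosa_space;
  vacuum : vosa_space;
  conformal : vosa_space;
  central_charge : F;
  vosa_fields : vertex_operator_map vosa_Y;
  vosa_jacobi : jacobi_identity vosa_Y vosa_Y;
  vacuum_even : homog false vacuum;
  vosa_vacuum : forall n v, vosa_Y vacuum n v = if n == -1 then v else 0;
  vosa_creation : forall v, vosa_Y v (-1) vacuum = v /\
    forall n : int, 0 <= n -> vosa_Y v n vacuum = 0;
  conformal_even : homog false conformal;
  vosa_virasoro : forall (m n : int) v,
    vir vosa_Y conformal m (vir vosa_Y conformal n v)
      - vir vosa_Y conformal n (vir vosa_Y conformal m v)
    = (m - n)%:~R *: vir vosa_Y conformal (m + n) v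
      + ((m ^+ 3 - m)%:~R / 12%:R * (m + n == 0)%:R * central_charge) *: v;
  vosa_derivative : forall v n w,
    vosa_Y (vir vosa_Y conformal (-1) v) n w = - n%:~R *: vosa_Y v (n - 1) w;
  vosa_grading : spanned_by_family (eigenvector (vir vosa_Y conformal 0));
  vosa_finite : forall h, finite_dim (eigenvector (vir vosa_Y conformal 0) h);
  vosa_weights : exists N : int, forall h v, v <> 0 ->
    eigenvector (vir vosa_Y conformal 0) h v ->
    exists z : int, N <= z /\ 2%:R * h = z%:~R }.

Record vmodule (F : numFieldType) (V : vosa F) : Type := VModule {
  mod_space :> superspace F;
  mod_Y : V -> int -> mod_space -> mod_space;
  mod_fields : vertex_operator_map mod_Y;
  mod_jacobi : jacobi_identity (@vosa_Y F V) mod_Y;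
  mod_vacuum : forall n w, mod_Y (vacuum V) n w = if n == -1 then w else 0;
  mod_derivative : forall v n w,
    mod_Y (vir (@vosa_Y F V) (conformal V) (-1) v) n w
    = - n%:~R *: mod_Y v (n - 1) w }.

Definition mod_L0 (F : numFieldType) (V : vosa F) (M : vmodule V) : M -> M :=
  vir (@mod_Y F V M) (conformal V) 0.

Definition is_submodule (F : numFieldType) (V : vosa F) (M : vmodule V)
    (S : M -> Prop) : Prop :=
  [/\ S 0,
      forall a x y, S x -> S y -> S (a *: x + y),
      forall y z, homog false y -> homog true z -> S (y + z) -> S y /\ S z
    & forall v n x, S x -> S (mod_Y v n x)].

(* Existence of a composition series 0 = S_0 < S_1 < ... < S_m = M. *)
Definition finite_length (F : numFieldType) (V : vosa F) (M : vmodule V) : Prop :=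
  exists (m : nat) (S : nat -> M -> Prop),
    [/\ forall i, (i <= m)%N -> is_submodule (S i),
        forall x, S 0%N x <-> x = 0,
        forall x, S m x
      & forall i, (i < m)%N ->
          [/\ forall x, S i x -> S i.+1 x,
              exists2 x, S i.+1 x & ~ S i x
            & forall T : M -> Prop, is_submodule T ->
                (forall x, S i x -> T x) -> (forall x, T x -> S i.+1 x) ->
                (forall x, T x <-> S i x) \/ (forall x, T x <-> S i.+1 x)]].

Definition grading_restricted (F : numFieldType) (V : vosa F) (M : vmodule V) :
    Prop :=
  [/\ spanned_by_family (gen_eigenvector (@mod_L0 F V M)),
      forall h, finite_dim (gen_eigenvector (@mod_L0 F V M) h)
    & forall h, exists N : nat, forall m : nat, (N <= m)%N ->
        forall x, gen_eigenvector (@mod_L0 F V M) (h - m%:R) x -> x = 0].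

Definition homog_morphism (F : numFieldType) (V : vosa F) (M N : vmodule V)
    (p : bool) (f : M -> N) : Prop :=
  [/\ is_linear f, has_parity p f
    & forall q v n x, homog q v ->
        f (mod_Y v n x) = (-1) ^+ (p && q) *: mod_Y v n (f x)].

(* Hom spaces are superspaces: a morphism is the sum of an even and an odd
   one. *)
Definition morphism (F : numFieldType) (V : vosa F) (M N : vmodule V)
    (f : M -> N) : Prop :=
  exists f0 f1 : M -> N, [/\ homog_morphism false f0, homog_morphism true f1
    & forall x, f x = f0 x + f1 x].

Definition aff_act (F : numFieldType) (V : vosa F) (gen : gl11 -> V)
    (M : vmodule V) (a : gl11) (r : int) : M -> M :=
  mod_Y (gen a) r.

(* [V] is V_k(gl(1|1)), [gen a] being the vector a_{-1} 1: the modes of the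
   fields Y(gen a, z) make [V] the level-[k] module induced from the trivial
   module C 1, and the conformal vector is the prescribed one. *)
Definition is_affine_vosa (F : numFieldType) (k : F) (V : vosa F)
    (gen : gl11 -> V) : Prop :=
  let A a r (v : V) := vosa_Y (gen a) r v in
  let one := vacuum V in
  [/\ forall a, homog (gl_par a) (gen a),
      is_induced k (@triv_act F) A (fun c : triv_space F => (c : F) *: one)
    & conformal V =
        (2%:R * k)^-1 *:
          (A gN (-1) (A gE (-1) one) + A gE (-1) (A gN (-1) one)
           - A psi_p (-1) (A psi_m (-1) one) + A psi_m (-1) (A psi_p (-1) one))
        + (2%:R * k ^+ 2)^-1 *: A gE (-1) (A gE (-1) one)].

Definition in_Ofin (F : numFieldType) (V : vosa F) (gen : gl11 -> V)
    (M : vmodule V) : Prop :=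
  [/\ finite_length M,
      grading_restricted M,
      semisimple_op (@aff_act F V gen M gN 0)
    & semisimple_op (@aff_act F V gen M gE 0)].

Definition projective_in_Ofin (F : numFieldType) (V : vosa F) (gen : gl11 -> V)
    (P : vmodule V) : Prop :=
  in_Ofin gen P /\
  forall M N : vmodule V, in_Ofin gen M -> in_Ofin gen N ->
  forall (s : M -> N) (f : P -> N),
    morphism s -> (forall y, exists x, s x = y) -> morphism f ->
    exists2 g : P -> M, morphism g & forall x, s (g x) = f x.

(* The V_k(gl(1|1))-module [W] is the affine module induced from V_{n,e},
   whose highest-weight vector has parity [p]. *)
Definition is_Vhat (F : numFieldType) (k : F) (V : vosa F) (gen : gl11 -> V)
    (p : bool) (n e : F) (W : vmodule V) : Prop :=
  exists j : verma_space F p -> W,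
    is_induced k (@verma_act F p n e) (@aff_act F V gen W) j.

(* Main.v *)
(* Fix E_0 = e with e/k not an integer.  Every pair of dual modes then has an
   invertible (anti)commutator: [{psi+_r, psi-_-r} = e + rk] and
   [[N_r, E_-r] = rk] for r != 0.  Up to terms that are smaller for a suitable
   filtration, the affine algebra thus acts through Clifford and Heisenberg
   algebras.  A number operator that is triangular for this filtration shows
   that the induced module is irreducible.  In any module of the category on
   which E_0 = e, a vector can be corrected, one annihilation operator at a
   time, to a highest-weight vector without changing its image in a quotient
   where that image already is a highest-weight vector.  So highest-weight
   vectors lift along surjections, and by the universal property so do the
   morphisms from the induced module.  The L_0-grading enters only to make the
   Heisenberg annihilation operators locally nilpotent and to bound the sizes of
   the graded pieces. *)

From HB Require Import structures.
Require Import Defs.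
From mathcomp Require Import all_boot all_order all_algebra.
From mathcomp Require Import boolp reals complex.
From mathcomp Require Import ring zify.

Set Implicit Arguments.
Unset Strict Implicit.
Unset Printing Implicit Defensive.

Import Order.TTheory GRing.Theory Num.Theory.
Local Open Scope ring_scope.

(** Brackets preserve the conformal weight, so it cannot be the filtration for the number operator:
    the E produced by two fermions would not count as smaller. In [fock_wt] the creation modes of E,
    of the fermions and of N therefore grow with slopes 1, 2 and 3, and dual modes get opposite
    weights. The offset 1 makes psi^-_0 a creation operator; the offset 2 for N and its dual is
    forced by {psi^+_0, psi^-_1} = E_1, whose weight must lie below -4. The induced module is known
    only through its universal property. Uniqueness there yields generation by the image of [j],
    existence yields maps out of it; no PBW basis enters, and the number operator does the work of
    linear independence. Morphisms may mix parities, so the image of the top vector need not be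
    homogeneous, and odd modes commute with a morphism only up to signs that differ on its two
    parts. The lift is therefore built from an even and an odd map, the odd one as an even map to a
    parity shift. *)

Section Linear.
Variables (F : numFieldType) (M N : lmodType F) (f : M -> N).
Hypothesis hf : is_linear f.

Lemma lin0 : f 0 = 0.
Proof. by have := hf (-1) 0 0; rewrite !scaleN1r !addNr. Qed.

Lemma linD x y : f (x + y) = f x + f y.
Proof. by rewrite -[x in LHS]scale1r hf scale1r. Qed.

Lemma linZ a x : f (a *: x) = a *: f x.
Proof. by rewrite -[in LHS](addr0 (a *: x)) hf lin0 addr0. Qed.

Lemma linN x : f (- x) = - f x.
Proof. by rewrite -scaleN1r linZ scaleN1r. Qed.

Lemma linB x y : f (x - y) = f x - f y.
Proof. by rewrite linD linN. Qed.

Lemma lin_sum I (r : seq I) (P : pred I) (g : I -> M) :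
  f (\sum_(i <- r | P i) g i) = \sum_(i <- r | P i) f (g i).
Proof. by apply: (big_morph f linD lin0). Qed.

End Linear.

Lemma is_linearD (F : numFieldType) (M N : lmodType F) (f g : M -> N) :
  is_linear f -> is_linear g -> is_linear (fun x => f x + g x).
Proof. by move=> hf hg a x y; rewrite hf hg scalerDr addrACA. Qed.

Lemma is_linearZ (F : numFieldType) (M N : lmodType F) (c : F) (f : M -> N) :
  is_linear f -> is_linear (fun x => c *: f x).
Proof.
by move=> hf a x y; rewrite hf scalerDr !scalerA mulrC.
Qed.

Lemma is_linearB (F : numFieldType) (M N : lmodType F) (f g : M -> N) :
  is_linear f -> is_linear g -> is_linear (fun x => f x - g x).
Proof.
move=> hf hg; have hNg := is_linearZ (-1) hg => a x y.
by have := is_linearD hf hNg a x y; rewrite !scaleN1r.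
Qed.

(** * Subspaces, combinations over the basis of gl(1|1), and superspaces *)

Definition subspace (F : numFieldType) (M : lmodType F) (S : M -> Prop) : Prop :=
  S 0 /\ forall (a : F) x y, S x -> S y -> S (a *: x + y).

Section Subspace.
Variables (F : numFieldType) (M : lmodType F) (S : M -> Prop).
Hypothesis hS : subspace S.

Lemma subspaceZ a x : S x -> S (a *: x).
Proof. by move=> hx; rewrite -[a *: x]addr0; apply: hS.2 => //; apply: hS.1. Qed.

Lemma subspaceD x y : S x -> S y -> S (x + y).
Proof. by move=> hx hy; rewrite -[x]scale1r; apply: hS.2. Qed.

Lemma subspaceN x : S x -> S (- x).
Proof. by move=> hx; rewrite -scaleN1r; apply: subspaceZ. Qed.

Lemma subspaceB x y : S x -> S y -> S (x - y).
Proof. by move=> hx hy; apply: subspaceD => //; apply: subspaceN. Qed.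

Lemma subspace_sum I (r : seq I) (P : pred I) (g : I -> M) :
  (forall i, P i -> S (g i)) -> S (\sum_(i <- r | P i) g i).
Proof.
by move=> h; elim/big_rec: _ => [|i x hi hx]; [apply: hS.1|apply/subspaceD/hx/h].
Qed.

End Subspace.

Lemma subspace_comb (F : numFieldType) (M : lmodType F) (S : M -> Prop)
    (c : gl11 -> F) (f : gl11 -> M) :
  subspace S -> (forall d, c d != 0 -> S (f d)) -> S (gl_comb c f).
Proof.
move=> hS h; have hd d : S (c d *: f d).
  have [->|/h hc] := eqVneq (c d) 0; first by rewrite scale0r; apply: hS.1.
  exact: subspaceZ.
by rewrite /gl_comb; do 3?apply: (subspaceD hS).
Qed.

Lemma eq_gl_comb (F : numFieldType) (M : lmodType F) (c : gl11 -> F)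
    (f g : gl11 -> M) :
  (forall d, c d != 0 -> f d = g d) -> gl_comb c f = gl_comb c g.
Proof.
move=> h; have hd d : c d *: f d = c d *: g d.
  by have [->|/h ->//] := eqVneq (c d) 0; rewrite !scale0r.
by rewrite /gl_comb !hd.
Qed.

Lemma lin_comb (F : numFieldType) (M N : lmodType F) (h : M -> N)
    (c : gl11 -> F) (f : gl11 -> M) :
  is_linear h -> h (gl_comb c f) = gl_comb c (fun d => h (f d)).
Proof. by move=> hh; rewrite /gl_comb !(linD hh) !(linZ hh). Qed.

Lemma gl_comb0 (F : numFieldType) (M : lmodType F) (c : gl11 -> F)
    (f : gl11 -> M) :
  (forall d, c d != 0 -> f d = 0) -> gl_comb c f = 0.
Proof. by move=> /(@eq_gl_comb F M c f (fun=> 0)) ->; rewrite /gl_comb !scaler0 !addr0. Qed.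

Section Superspace.
Variables (F : numFieldType) (M : superspace F).
Implicit Types (x y : M) (q : bool).

Lemma homog_subspace q : subspace (@homog F M q).
Proof.
split; last exact: homog_lin.
have [y [z [hy hz _]]] := homog_sum (0 : M).
case: q; [have := homog_lin (-1) hz hz|have := homog_lin (-1) hy hy];
  by rewrite scaleN1r addNr.
Qed.

Lemma homog_split p x :
  exists y z, [/\ homog p y, homog (~~ p) z & x = y + z].
Proof.
have [y [z [hy hz ->]]] := homog_sum x; case: p; last by exists y, z.
by exists z, y; rewrite addrC.
Qed.

Lemma homog_split_eq p y z y' z' :
  homog p y -> homog (~~ p) z -> homog p y' -> homog (~~ p) z' ->
  y + z = y' + z' -> y = y' /\ z = z'.
Proof.
move=> hy hz hy' hz' E.
have D : y - y' = z' - z.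
  by rewrite -[in LHS](addrK z y) E addrAC [y' + z']addrC addrK.
have h0 : y - y' = 0.
  have h1 : homog p (y - y') by apply: (subspaceB (homog_subspace p)).
  have h2 : homog (~~ p) (y - y').
    by rewrite D; apply: (subspaceB (homog_subspace (~~ p))).
  by case: p h1 h2 {hy hz hy' hz'} => h1 h2; apply: homog_direct.
split; first exact/subr0_eq.
by move: D; rewrite h0 => /esym/subr0_eq.
Qed.

End Superspace.

(** * Modules over the affine superalgebra and highest-weight vectors *)

Lemma affine_lin (F : numFieldType) (k : F) (M : superspace F) act a r :
  @is_affine_module F k M act -> is_linear (act a r).
Proof. by case. Qed.

Lemma affine_par (F : numFieldType) (k : F) (M : superspace F) act a r :
  @is_affine_module F k M act -> has_parity (gl_par a) (act a r).
Proof. by case. Qed.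

Lemma affine_swap (F : numFieldType) (k : F) (M : superspace F) act a b r s x :
  @is_affine_module F k M act ->
  act a r (act b s x) = (-1) ^+ (gl_par a && gl_par b) *: act b s (act a r x)
    + (gl_comb (gl_br F a b) (fun c => act c (r + s) x)
       + (r%:~R * gl_kappa F a b * (r + s == 0)%:R * k) *: x).
Proof. by case=> _ _ <-; rewrite addrC subrK. Qed.

Definition is_hw (F : numFieldType) (M : superspace F)
    (act : gl11 -> int -> M -> M) (nu e : F) (y : M) : Prop :=
  [/\ act gN 0 y = nu *: y, act gE 0 y = e *: y, act psi_p 0 y = 0
    & forall a r, 0 < r -> act a r y = 0].

Definition dual_gen (a : gl11) : gl11 :=
  match a with gN => gE | gE => gN | psi_p => psi_m | psi_m => psi_p end.

(** * Submodules and generation of induced modules *)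

Section SubSuperspace.
Variables (F : numFieldType) (M : superspace F) (S : M -> Prop).
Hypothesis hS : subspace S.
Hypothesis grS : forall x, S x ->
  exists y z, [/\ homog false y, homog true z, S y, S z & x = y + z].

(** The universal property ranges over modules as types, so a subspace given as a [Prop] is turned
    into a subtype through its classical truth value. *)
Definition subb : pred M := fun x => `[< S x >].

Lemma subb_closed : submod_closed subb.
Proof.
split; first by apply/asboolP; apply: hS.1.
by move=> a x y /asboolP hx /asboolP hy; apply/asboolP; apply: hS.2.
Qed.

HB.instance Definition _ := GRing.isSubmodClosed.Build F M subb subb_closed.

Definition sub_sort := {x : M | subb x}.
HB.instance Definition _ := SubType.on sub_sort.
HB.instance Definition _ := Choice.on sub_sort.
HB.instance Definition _ := [SubChoice_isSubLmodule of sub_sort by <:].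

Definition sub_homog (q : bool) (x : sub_sort) : Prop := homog q (val x).

Lemma sub_homog_lin q (a : F) x y :
  sub_homog q x -> sub_homog q y -> sub_homog q (a *: x + y).
Proof. by rewrite /sub_homog; apply: homog_lin. Qed.

Lemma sub_homog_direct x : sub_homog false x -> sub_homog true x -> x = 0.
Proof. by move=> h0 h1; apply: val_inj; apply: homog_direct. Qed.

Lemma sub_homog_sum x :
  exists y z, [/\ sub_homog false y, sub_homog true z & x = y + z].
Proof.
have [y [z [h0 h1 /asboolP sy /asboolP sz E]]] := grS (asboolW (valP x)).
by exists (Sub y sy), (Sub z sz); split => //; apply: val_inj.
Qed.

Definition sub_superspace : superspace F :=
  Superspace sub_homog_lin sub_homog_direct sub_homog_sum.

End SubSuperspace.

(* The uniqueness part of the universal property, applied to the endomorphism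
   of M that factors through the given submodule. *)
Lemma induced_generated_graded (F : numFieldType) (k : F) (U M : superspace F)
    gact act (j : U -> M) (S : M -> Prop) :
  is_induced k gact act j -> subspace S ->
  (forall x, S x ->
    exists y z, [/\ homog false y, homog true z, S y, S z & x = y + z]) ->
  (forall a r x, S x -> S (act a r x)) -> (forall u, S (j u)) ->
  forall x, S x.
Proof.
move=> [hM [jl jp j0 jr] univ] hS grS hact hj.
pose X := sub_superspace hS grS.
pose v (x : X) : M := val x.
have vP (x : X) : S (v x) by apply: asboolW; apply: (valP x).
have vI : injective v by apply: val_inj.
have mk x : S x -> `[< S x >] by move/asboolP.
pose ax a r (x : X) : X := Sub (act a r (v x)) (mk _ (hact a r _ (vP x))).
pose phi u : X := Sub (j u) (mk _ (hj u)).
have vD (a : F) (x y : X) : v (a *: x + y) = a *: v x + v y by [].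
have vax a r x : v (ax a r x) = act a r (v x) by [].
have vphi u : v (phi u) = j u by [].
have hX : is_affine_module k ax.
  split=> [a r c x y|a r q x hx|a b r s x].
  - by apply: vI; rewrite vax !vD !vax (affine_lin a r hM).
  - exact: (affine_par _ _ hM).
  - apply: vI; rewrite (linB vD) (linD vD) !(linZ vD) (lin_comb _ _ vD) !vax.
    by rewrite (affine_swap a b r s _ hM) addrAC subrr add0r.
have hphi : is_top_map gact ax phi.
  split=> [c x y|q u hu|a u|a r u r0].
  - by apply: vI; rewrite vD !vphi jl.
  - exact: jp hu.
  - by apply: vI; rewrite vax !vphi j0.
  - by apply: vI; rewrite vax vphi jr // -[in RHS](subrr (0 : X)) (linB vD) subrr.
have [h [[hl hp ha] hu _]] := univ X ax phi hX hphi.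
have [g [_ _ gU]] := univ M act j hM (And4 jl jp j0 jr).
have E1 : forall x, v (h x) = g x.
  apply: (gU (fun x => v (h x))).
    split=> [a x y|q x hx|a r x]; first by rewrite hl vD.
      by have := hp q x hx.
    by rewrite ha.
  by move=> u; rewrite hu.
have E2 : forall x, x = g x by apply: (gU id); split => //.
by move=> x; rewrite (E2 x) -E1.
Qed.

(** The universal property sees only graded submodules. An ungraded [S] is replaced by the sums of
    homogeneous vectors that lie in [S]; these form a graded submodule. *)
Lemma induced_generated (F : numFieldType) (k : F) (U M : superspace F)
    gact act (j : U -> M) (S : M -> Prop) :
  is_induced k gact act j -> subspace S ->
  (forall a r x, S x -> S (act a r x)) -> (forall u, S (j u)) ->
  forall x, S x.
Proof.
move=> hI hS hact hj x.
pose S' x := exists y z, [/\ homog false y, homog true z, S y, S z & x = y + z].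
have [hM [jl jp _ _] _] := hI.
suff [y [z [_ _ sy sz ->]]] : S' x by apply: (subspaceD hS).
have H0 q : homog q (0 : M) by apply: (homog_subspace M q).1.
apply: (induced_generated_graded hI) x.
- split; first by exists 0, 0; split => //; rewrite ?addr0 //; apply: hS.1.
  move=> a _ _ [y [z [hy hz sy sz ->]]] [y' [z' [hy' hz' sy' sz' ->]]].
  exists (a *: y + y'), (a *: z + z'); split; last by rewrite scalerDr addrACA.
  + exact: homog_lin.
  + exact: homog_lin.
  + exact: hS.2.
  + exact: hS.2.
- move=> _ [y [z [hy hz sy sz ->]]]; exists y, z; split => //.
  + by exists y, 0; rewrite addr0; split => //; apply: hS.1.
  + by exists 0, z; rewrite add0r; split => //; apply: hS.1.
- move=> a r _ [y [z [hy hz sy sz ->]]].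
  have h1 := affine_par a r hM hy; have h2 := affine_par a r hM hz.
  have E := linD (affine_lin a r hM) y z.
  case: (gl_par a) h1 h2 => h1 h2.
    by exists (act a r z), (act a r y); split => //; rewrite ?E 1?addrC //; apply: hact.
  by exists (act a r y), (act a r z); split => //; apply: hact.
- move=> u; have [y [z [hy hz ->]]] := homog_sum u.
  exists (j y), (j z); split; [exact: jp hy|exact: jp hz|by []|by []|].
  exact: linD.
Qed.

(** * Filtrations by creation operators *)

(* [filt f] is spanned by the monomials in the creation operators (the modes of
   positive weight) of total weight at most [f], applied to [B]. *)
Inductive filt (F : numFieldType) (M : superspace F)
    (act : gl11 -> int -> M -> M) (wt : gl11 -> int -> int) (B : M -> Prop) :
    int -> M -> Prop :=
| filt_base f x : 0 <= f -> B x -> filt act wt B f x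
| filt_0 f : filt act wt B f 0
| filt_lin f a x y :
    filt act wt B f x -> filt act wt B f y -> filt act wt B f (a *: x + y)
| filt_act f g a r x :
    0 < wt a r -> filt act wt B f x -> f + wt a r <= g ->
    filt act wt B g (act a r x).

Section Filtration.
Variables (F : numFieldType) (k : F) (M : superspace F).
Variables (act : gl11 -> int -> M -> M) (wt : gl11 -> int -> int).
Variable (B : M -> Prop).
Hypothesis hM : is_affine_module k act.
Hypothesis hB : subspace B.

Local Notation filt := (filt act wt B).

Lemma filt_subspace f : subspace (filt f).
Proof. by split; [apply: filt_0|move=> *; apply: filt_lin]. Qed.

Lemma filt_mono f g x : f <= g -> filt f x -> filt g x.
Proof.
move=> fg h; elim: h g fg => {f x} [f x f0 hx|f|f a x y _ IHx _ IHy|f g a r x w hx _ fg] h hg.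
- by apply: filt_base => //; apply: le_trans hg.
- exact: filt_0.
- by apply: filt_lin; [apply: IHx|apply: IHy].
- by apply: filt_act w hx _; apply: le_trans hg.
Qed.

Lemma filt_lt0 f x : filt f x -> f < 0 -> x = 0.
Proof.
elim=> {f x} [f x|//|f a x y _ IHx _ IHy hf|f g a r x w _ IH fg hg].
- by rewrite leNgt => /negP.
- by rewrite IHx // IHy // scaler0 addr0.
- by rewrite IH ?(lin0 (affine_lin _ _ hM)) //; lia.
Qed.

(** Creation weights are positive integers, so a creation operator that ends in degree at most 0
    acted on a vector of negative degree, which is 0. *)
Lemma filt_le0 f x : filt f x -> f <= 0 -> B x.
Proof.
elim=> {f x} [f x _ //|f _|f a x y _ IHx _ IHy hf|f g a r x w hx _ fg hg].
- exact: hB.1.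
- by apply: hB.2; [apply: IHx|apply: IHy].
- rewrite (filt_lt0 hx) ?(lin0 (affine_lin _ _ hM)); first exact: hB.1.
  lia.
Qed.

Hypothesis wtD : forall a b c r s,
  gl_br F a b c != 0 -> wt c (r + s) <= wt a r + wt b s.
Hypothesis wt_kappa : forall a b r,
  gl_kappa F a b != 0 -> 0 <= wt a r + wt b (- r).
Hypothesis wt_lt0 : forall a r x, wt a r < 0 -> B x -> act a r x = 0.
Hypothesis wt_eq0 : forall a r x, wt a r = 0 -> B x -> B (act a r x).

Lemma filt_comb f a b r s x :
  (forall c t, filt (f + wt c t) (act c t x)) ->
  filt (f + (wt a r + wt b s)) (gl_comb (gl_br F a b) (fun c => act c (r + s) x)).
Proof.
move=> h; apply: subspace_comb => [|c hc]; first exact: filt_subspace.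
by apply: filt_mono (h c (r + s)); rewrite lerD2l; apply: wtD.
Qed.

Lemma filt_kappa f a b r s x : filt f x ->
  filt (f + (wt a r + wt b s)) ((r%:~R * gl_kappa F a b * (r + s == 0)%:R * k) *: x).
Proof.
move=> h; have [/eqP|_] := eqVneq (r + s) 0; last first.
  by rewrite mulr0 mul0r scale0r; apply: filt_0.
rewrite addrC addr_eq0 => /eqP ->.
have [->|hk] := eqVneq (gl_kappa F a b) 0.
  by rewrite mulr0 !mul0r scale0r; apply: filt_0.
apply: (subspaceZ (filt_subspace _)); apply: filt_mono h.
by rewrite lerDl; apply: wt_kappa.
Qed.

(** A mode is moved past the creation operators until it meets [B]. The brackets left behind have no
    larger weight by [wtD], and a central term occurs only where the two weights add up to at least
    0. *)
Lemma filt_closed f x : filt f x -> forall a r, filt (f + wt a r) (act a r x).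
Proof.
elim=> {f x} [f x f0 hx a r|f a r|f c x y _ IHx _ IHy a r|f g b s x w hx IH fg a r].
- have [h|h|h] := ltgtP (wt a r) 0.
  + by rewrite wt_lt0 //; apply: filt_0.
  + by apply: (filt_act h (filt_base act wt f0 hx)).
  + by apply: filt_base; [rewrite h addr0|apply: wt_eq0].
- by rewrite (lin0 (affine_lin _ _ hM)); apply: filt_0.
- by rewrite (affine_lin _ _ hM); apply: filt_lin.
- rewrite (affine_swap _ _ _ _ _ hM).
  have S := filt_subspace (g + wt a r); apply: (subspaceD S).
    apply: (subspaceZ S); apply: filt_act w (IH a r) _.
    by rewrite addrAC lerD2r.
  apply: (@filt_mono (f + (wt a r + wt b s))).
    by rewrite addrC -addrA addrC [wt b s + f]addrC lerD2r.
  apply: (subspaceD (filt_subspace _)); first exact: filt_comb.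
  exact: filt_kappa.
Qed.

Lemma filt_exhaust (U : superspace F) gact (j : U -> M) :
  is_induced k gact act j -> (forall u, exists f, filt f (j u)) ->
  forall x, exists f, filt f x.
Proof.
move=> hI hj; apply: (induced_generated hI) => //.
- split; first by exists 0; apply: filt_0.
  move=> a x y [f hx] [g hy]; exists (Num.max f g).
  by apply: filt_lin; [apply: filt_mono hx|apply: filt_mono hy];
    rewrite le_max lexx ?orbT.
- by move=> a r x [f hx]; exists (f + wt a r); apply: filt_closed.
Qed.

End Filtration.

(** * Finite spanning sets *)

Definition spans (F : numFieldType) (M : lmodType F) (s : seq M) (x : M) : Prop :=
  forall S : M -> Prop, subspace S -> (forall i, (i < size s)%N -> S s`_i) -> S x.

Lemma spans_finite_dim (F : numFieldType) (M : lmodType F) (P : M -> Prop) s :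
  (forall x, P x -> spans s x) -> finite_dim P.
Proof.
move=> h; exists s => x hx.
apply: (h x hx (fun x => exists c : nat -> F, x = \sum_(i < size s) c i *: s`_i))
  => [|i hi].
  split; first by exists (fun=> 0); rewrite big1 // => i _; rewrite scale0r.
  move=> a _ _ [c ->] [d ->]; exists (fun i => a * c i + d i).
  rewrite scaler_sumr -big_split; apply: eq_bigr => i _ /=.
  by rewrite scalerDl scalerA.
exists (fun j => (i == j)%:R); rewrite (bigD1 (Ordinal hi)) //= eqxx scale1r.
rewrite big1 ?addr0 // => j; rewrite eq_sym -val_eqE /= => /negPf ->.
by rewrite scale0r.
Qed.

Lemma spans_nth (F : numFieldType) (M : lmodType F) (s : seq M) x :
  x \in s -> spans s x.
Proof.
by move=> hx S _ h; rewrite -(nth_index 0 hx); apply: h; rewrite index_mem.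
Qed.

Lemma spans_subspace (F : numFieldType) (M : lmodType F) (s : seq M) :
  subspace (spans s).
Proof.
split; first by move=> S hS _; apply: hS.1.
by move=> a x y hx hy S hS h; apply: hS.2; [apply: hx|apply: hy].
Qed.

Lemma spans_trans (F : numFieldType) (M : lmodType F) (s t : seq M) x :
  {in s, forall y, spans t y} -> spans s x -> spans t x.
Proof.
by move=> h hx; apply: hx; [apply: spans_subspace|move=> i hi; apply: h; rewrite mem_nth].
Qed.

Lemma spans_map (F : numFieldType) (M : lmodType F) (f : M -> M) (s : seq M) x :
  is_linear f -> spans s x -> spans (map f s) (f x).
Proof.
move=> hf hx; apply: (hx (fun x => spans (map f s) (f x))) => [|i hi].
  split; first by rewrite (lin0 hf); apply: (spans_subspace _).1.
  by move=> a y z hy hz; rewrite hf; apply: (spans_subspace _).2.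
by apply: spans_nth; apply: map_f; rewrite mem_nth.
Qed.

(** For the weight -r the outermost creation operator of a vector of degree at most d has one of the
    mode numbers -1, ..., -d, and its argument has smaller degree. So the spanning sets of the
    smaller degrees and four generators give one for d. *)
Lemma level_finite (F : numFieldType) (k : F) (M : superspace F) act
    (B : M -> Prop) (b : seq M) :
  is_affine_module k act -> (forall x, B x -> spans b x) ->
  forall d : nat, exists s, forall f x, f <= d%:Z ->
    filt act (fun _ r => - r) B f x -> spans s x.
Proof.
move=> hM hb d.
elim/ltn_ind: d => d IH.
have [t ht] : {t : nat -> seq M & forall i, (i < d)%N -> forall f x,
    f <= i%:Z -> filt act (fun _ r => - r) B f x -> spans (t i) x}.
  apply: (@choice nat (seq M) (fun i t => (i < d)%N -> forall f x,
    f <= i%:Z -> filt act (fun _ r => - r) B f x -> spans t x)) => i.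
  by case: (ltnP i d) => [/IH [s hs]|_]; [exists s|exists [::]].
pose gens := [:: gN; gE; psi_p; psi_m].
pose s := b ++ flatten [seq flatten [seq [seq act a (- (d - i)%:Z) y | y <- t i]
   | a <- gens] | i <- iota 0 d].
exists s => f x fd h.
elim: h fd => {f x} [f x _ hx _|f _|f a x y _ IHx _ IHy hf|f g a r x w hx _ fg gd].
- apply: spans_trans (hb x hx) => y hy; apply: spans_nth.
  by rewrite mem_cat hy.
- exact: (spans_subspace _).1.
- by apply: (spans_subspace _).2; [apply: IHx|apply: IHy].
have [f0|f0] := ltP f 0.
  by rewrite (filt_lt0 hM hx f0) (lin0 (affine_lin _ _ hM)); apply: (spans_subspace _).1.
(* The degree left for the argument is d + r, which is below d because r is negative. *)
have [i [hi fi ri]] : exists i : nat, [/\ (i < d)%N, f <= i%:Z & r = - (d - i)%:Z].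
  by exists `|(d%:Z + r)%R|%N; split; lia.
have := spans_map (affine_lin a r hM) (ht i hi f x fi hx).
apply: spans_trans => y hy; apply: spans_nth; rewrite mem_cat; apply/orP; right.
apply/flattenP; exists (flatten [seq [seq act a (- (d - i)%:Z) y | y <- t i] | a <- gens]).
  by apply/mapP; exists i => //; rewrite mem_iota.
by rewrite /= ri in hy *; case: a hy {w} => hy; rewrite !mem_cat hy ?orbT.
Qed.

(** * Irreducibility via the number operator *)

(* Chosen so that the superbracket of two modes of nonzero weight that are not
   dual to each other has strictly smaller weight than the two together. *)
Definition fock_wt (a : gl11) (r : int) : int :=
  match a with
  | gN => if r < 0 then 2 - 3 * r else - r
  | gE => if 0 < r then - (3 * r + 2) else - r
  | psi_p => if r < 0 then 1 - 2 * r else - 1 - 2 * r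
  | psi_m => if r <= 0 then 1 - 2 * r else - 1 - 2 * r
  end.

Lemma fock_wt_dual a r : fock_wt (dual_gen a) (- r) = - fock_wt a r.
Proof. by case: a => /=; repeat case: ifP; lia. Qed.

Lemma fock_wtD (F : numFieldType) a b c r s :
  gl_br F a b c != 0 -> fock_wt c (r + s) <= fock_wt a r + fock_wt b s.
Proof.
by case: a; case: b; case: c => /=; rewrite ?eqxx //= => _;
  repeat case: ifP; lia.
Qed.

Lemma fock_wtD_lt (F : numFieldType) a b c r s :
  gl_br F a b c != 0 -> fock_wt a r != 0 -> fock_wt b s != 0 ->
  s <> - r \/ dual_gen a <> b ->
  fock_wt c (r + s) <= fock_wt a r + fock_wt b s - 1.
Proof.
by case: a; case: b; case: c => /=; rewrite ?eqxx //= => _ + + [H|H] //;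
  repeat case: ifP; lia.
Qed.

Lemma fock_wt_kappa (F : numFieldType) a b r :
  gl_kappa F a b != 0 -> 0 <= fock_wt a r + fock_wt b (- r).
Proof.
by case: a; case: b => /=; rewrite ?eqxx //= => _; repeat case: ifP; lia.
Qed.

Section Fock.
Variables (F : numFieldType) (k e nu : F) (M : superspace F).
Variables (act : gl11 -> int -> M -> M) (w : M).
Hypothesis hM : is_affine_module k act.
Hypothesis hE : forall x, act gE 0 x = e *: x.
Hypothesis hk : k != 0.
Hypothesis he : forall z : int, e + z%:~R * k != 0.
Hypothesis hw : is_hw act nu e w.

Local Notation line := (fun x : M => exists c : F, x = c *: w).
Local Notation fock := (filt act fock_wt line).

Let aL a r := affine_lin a r hM.

Lemma line_subspace : subspace line.
Proof.
split; first by exists 0; rewrite scale0r.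
by move=> a _ _ [c ->] [d ->]; exists (a * c + d); rewrite scalerDl scalerA.
Qed.

Lemma line_lt0 a r x : fock_wt a r < 0 -> line x -> act a r x = 0.
Proof.
have [_ _ h0 h] := hw.
move=> hr [c ->]; rewrite (linZ (aL a r)).
have [r0|r0] := ltP 0 r; first by rewrite h // scaler0.
case: a hr => /= hr; try by move: hr; repeat case: ifP; lia.
have -> : r = 0 by move: hr; case: ifP; lia.
by rewrite h0 scaler0.
Qed.

Lemma line_eq0 a r x : fock_wt a r = 0 -> line x -> line (act a r x).
Proof.
have [h1 h2 _ _] := hw.
move=> hr [c ->]; rewrite (linZ (aL a r)).
case: a hr => /= hr; try by move: hr; repeat case: ifP; lia.
  have -> : r = 0 by move: hr; case: ifP; lia.
  by exists (c * nu); rewrite h1 scalerA.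
have -> : r = 0 by move: hr; case: ifP; lia.
by exists (c * e); rewrite h2 scalerA.
Qed.

Let fock_sub f := filt_subspace act fock_wt line f.

Lemma fock_closed f x a r : fock f x -> fock (f + fock_wt a r) (act a r x).
Proof.
move=> h; apply: (filt_closed hM _ _ line_lt0 line_eq0 h).
  exact: fock_wtD.
exact: fock_wt_kappa.
Qed.

(** The scalar by which the superbracket of [act a r] with its dual mode acts once E_0 = e; E_0
    occurs only in the fermionic brackets. *)
Definition dual_norm a (r : int) : F :=
  (if gl_par a then e else 0) + r%:~R * gl_kappa F a (dual_gen a) * k.

Lemma dual_norm_neq0 a r : fock_wt a r < 0 -> dual_norm a r != 0.
Proof.
rewrite /dual_norm; case: a => /= hr; rewrite ?add0r ?mulr1 ?he //; last first.
  by rewrite mulrN1 -rmorphN he.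
all: by rewrite mulf_neq0 // intr_eq0; apply: contraTneq hr => ->.
Qed.

(** Divided by the norm, the dual mode times [act a r] counts the factors dual to a_r in a monomial;
    here each factor counts with its weight. *)
Definition occupation a (r : int) (x : M) : M :=
  if fock_wt a r < 0 then
    (- (fock_wt a r)%:~R / dual_norm a r) *: act (dual_gen a) (- r) (act a r x)
  else 0.

Lemma occupation_lin a r : is_linear (occupation a r).
Proof.
move=> c x y; rewrite /occupation; case: ifP => _; last by rewrite scaler0 addr0.
by rewrite !aL scalerDr !scalerA mulrC.
Qed.

Lemma occupation_dual a r x : 0 < fock_wt (dual_gen a) (- r) ->
  occupation a r (act (dual_gen a) (- r) x) =
  (fock_wt (dual_gen a) (- r))%:~R *: act (dual_gen a) (- r) x
  + act (dual_gen a) (- r) (occupation a r x).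
Proof.
rewrite fock_wt_dual oppr_gt0 /occupation => wr; rewrite wr.
rewrite (linZ (aL _ _)) (affine_swap a (dual_gen a) r (- r) x hM).
rewrite subrr eqxx mulr1 (linD (aL _ _)) (linZ (aL _ _)).
have -> : (gl_comb (gl_br F a (dual_gen a)) (fun c => act c 0 x)
    + (r%:~R * gl_kappa F a (dual_gen a) * k) *: x) = dual_norm a r *: x.
  rewrite /dual_norm scalerDl; congr (_ + _); rewrite /gl_comb.
  by case: (a) => /=; rewrite !scale0r ?scale1r ?hE !addr0 ?add0r.
rewrite !(linZ (aL _ _)) scalerDr [X in _ + X]scalerA mulfVK ?dual_norm_neq0 //.
rewrite mulrNz addrC; congr (_ + _).
have [sq|] := boolP (gl_par a); last by rewrite expr0 scale1r.
(* A fermionic mode squares to zero: its superbracket with itself vanishes and 2 is invertible. This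
   removes the term whose sign would spoil the commutator. *)
have -> : act (dual_gen a) (- r) (act (dual_gen a) (- r) (act a r x)) = 0.
  set y := act a r x; case: hM => _ _ /(_ (dual_gen a) (dual_gen a) (- r) (- r) y).
  suff h2 : forall z : M, z + z = 0 -> z = 0.
    case: (a) sq => //= _; rewrite expr1 scaleN1r opprK /gl_comb /= !scale0r;
      by rewrite mulr0 !mul0r scale0r !addr0 => /h2.
  move=> z zz; have : (2%:R : F) *: z = 0 by rewrite scaler_nat mulr2n.
  by move/eqP; rewrite scaler_eq0 pnatr_eq0 /= => /eqP.
by rewrite !scaler0.
Qed.

Lemma fock_swap f a b r s x : fock f x ->
  fock_wt a r != 0 -> fock_wt b s != 0 -> s <> - r \/ dual_gen a <> b ->
  fock (f + fock_wt a r + fock_wt b s - 1)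
     (act a r (act b s x) - (-1) ^+ (gl_par a && gl_par b) *: act b s (act a r x)).
Proof.
move=> hx ha hb hd; rewrite (affine_swap _ _ _ _ _ hM) [X in fock _ X]addrAC subrr add0r.
have -> : r%:~R * gl_kappa F a b * (r + s == 0)%:R * k = 0.
  have [/eqP|_] := eqVneq (r + s) 0; last by rewrite mulr0 mul0r.
  rewrite addrC addr_eq0 => /eqP sr.
  suff -> : gl_kappa F a b = 0 by rewrite mulr0 !mul0r.
  by case: hd => // hd; case: (a) (b) hd => [] [].
rewrite scale0r addr0; apply: subspace_comb => [|c hc]; first exact: fock_sub.
apply: filt_mono (fock_closed c (r + s) hx).
by have := fock_wtD_lt hc ha hb hd; lia.
Qed.

(** The product of a_r with its dual is even, so its commutator with b_s is a sum of two terms, each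
    containing one superbracket of modes that are not dual. Such a bracket loses one degree. *)
Lemma occupation_other f a b r s x : fock f x -> 0 < fock_wt b s ->
  0 <= r -> s <> - r \/ dual_gen a <> b ->
  fock (f + fock_wt b s - 1) (occupation a r (act b s x) - act b s (occupation a r x)).
Proof.
move=> hx hb r0 hd; rewrite /occupation.
case: ifP => wr; last first.
  by rewrite (lin0 (aL _ _)) subr0; apply: filt_0.
rewrite (linZ (aL _ _)) -scalerBr; apply: (subspaceZ (fock_sub _)).
set b' := dual_gen a; set q := (-1) ^+ (gl_par a && gl_par b) : F.
set y := act a r x.
have q2 : q * q = 1 by rewrite /q -expr2 sqrr_sign.
have -> : act b' (- r) (act a r (act b s x)) - act b s (act b' (- r) y)
  = act b' (- r) (act a r (act b s x) - q *: act b s y)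
    + q *: (act b' (- r) (act b s y) - q *: act b s (act b' (- r) y)).
  rewrite (linB (aL _ _)) (linZ (aL _ _)) scalerBr scalerA q2 scale1r.
  by rewrite addrA subrK.
have wr' : fock_wt b' (- r) = - fock_wt a r by apply: fock_wt_dual.
apply: (subspaceD (fock_sub _)).
  have := @fock_swap f a b r s x hx _ _ hd; rewrite -/y -/q => h.
  have /(fock_closed b' (- r)) := h ltac:(lia) ltac:(lia).
  by apply: filt_mono; lia.
apply: (subspaceZ (fock_sub _)).
have qb : q = (-1) ^+ (gl_par b' && gl_par b) by rewrite /q /b'; case: (a).
have hy : fock (f + fock_wt a r) y by apply: fock_closed.
(* The dual of a_r and b_s are both creation operators, and two of these are never dual to each
   other. *)
have hd' : s <> - - r \/ dual_gen b' <> b.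
  case: (EM (s <> - - r)) => [|/contrapT hs]; first by left.
  right=> hb'; move: hb' hb wr hs; rewrite /b' opprK => <-.
  by case: (a) => /=; repeat case: ifP; lia.
have := fock_swap hy _ _ hd'; rewrite -qb => h.
by apply: filt_mono (h _ _); lia.
Qed.

Definition gl_basis : seq gl11 := [:: gN; gE; psi_p; psi_m].

(** A sum over all modes would be infinite, so it is cut at [R] and used on a fixed vector for all
    large [R]. Indices from 0 suffice because every mode of negative weight has a nonnegative
    index. *)
Definition number_op (R : nat) (x : M) : M :=
  \sum_(i < R) \sum_(a <- gl_basis) occupation a i%:Z x.

Lemma number_op_lin R : is_linear (number_op R).
Proof.
move=> c x y; rewrite /number_op scaler_sumr -big_split; apply: eq_bigr => i _.
rewrite /= scaler_sumr -big_split; apply: eq_bigr => a _; exact: occupation_lin.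
Qed.

Lemma occupation_fock f a r x : fock f x -> fock f (occupation a r x).
Proof.
move=> h; rewrite /occupation; case: ifP => _; last exact: filt_0.
apply: (subspaceZ (fock_sub _)).
by apply: filt_mono (fock_closed _ _ (fock_closed _ _ h)); rewrite fock_wt_dual; lia.
Qed.

Lemma number_op_fock f R x : fock f x -> fock f (number_op R x).
Proof.
move=> h; apply: (subspace_sum (fock_sub _)) => i _.
by apply: (subspace_sum (fock_sub _)) => a _; apply: occupation_fock.
Qed.

(** Only the summand dual to b_s contributes in leading degree, and the bound on [R] puts it into
    the sum. *)
Lemma number_op_creation f b s x : fock f x -> 0 < fock_wt b s ->
  forall R : nat, (`|s| < R)%N ->
  fock (f + fock_wt b s - 1)
    (number_op R (act b s x) - act b s (number_op R x) - (fock_wt b s)%:~R *: act b s x).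
Proof.
move=> hx hb R hR; set v := _ *: act b s x.
set g := f + fock_wt b s - 1; have S := fock_sub g.
(* Positive weight forces s <= 0, so the mode dual to b_s has index |s|. *)
have hs : s = - (`|s|%N)%:Z by case: (b) hb => /=; repeat case: ifP; lia.
pose d a (r : int) := occupation a r (act b s x) - act b s (occupation a r x).
have other a r : 0 <= r -> s <> - r \/ dual_gen a <> b -> fock g (d a r).
  by move=> r0; apply: occupation_other.
have dual a : dual_gen a = b -> d a `|s|%N = v.
  move=> ha; rewrite /d hs -ha abszN absz_nat occupation_dual; last by rewrite -hs ha.
  by rewrite addrK /v -hs ha.
have -> : number_op R (act b s x) - act b s (number_op R x) =
    \sum_(i < R) \sum_(a <- gl_basis) d a i.
  rewrite /number_op (lin_sum (aL _ _)) -sumrB; apply: eq_bigr => i _.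
  by rewrite (lin_sum (aL _ _)) -sumrB.
rewrite (bigD1 (Ordinal hR)) //= addrAC; apply: (subspaceD S); last first.
  apply: (subspace_sum S) => i hi; apply: (subspace_sum S) => a _.
  apply: other => //; left => si; move: hi; rewrite -val_eqE /=; apply/negP.
  by rewrite negbK; lia.
have rot3 (x1 x2 x3 x4 : M) : x1 + (x2 + (x3 + x4)) = x3 + (x1 + (x2 + x4)).
  by rewrite (addrCA x2 x3) (addrCA x1 x3).
have rot4 (x1 x2 x3 x4 : M) : x1 + (x2 + (x3 + x4)) = x4 + (x1 + (x2 + x3)).
  by rewrite (addrC x3 x4) rot3.
rewrite !big_cons big_nil addr0.
case: (b) other dual => other dual.
- rewrite addrCA addrAC (dual gE) // subrr add0r.
  by apply: (subspaceD S); [|apply: (subspaceD S)]; apply: other => //; right.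
- rewrite addrAC (dual gN) // subrr add0r.
  by apply: (subspaceD S); [|apply: (subspaceD S)]; apply: other => //; right.
- rewrite rot4 addrAC (dual psi_m) // subrr add0r.
  by apply: (subspaceD S); [|apply: (subspaceD S)]; apply: other => //; right.
- rewrite rot3 addrAC (dual psi_p) // subrr add0r.
  by apply: (subspaceD S); [|apply: (subspaceD S)]; apply: other => //; right.
Qed.

Lemma number_op_line R x : line x -> number_op R x = 0.
Proof.
move=> hx; rewrite /number_op big1 // => i _; rewrite big1 // => a _.
rewrite /occupation; case: ifP => // wr.
by rewrite (line_lt0 wr hx) (lin0 (aL _ _)) scaler0.
Qed.

(** The number operator kills the line, and passing a creation operator adds its weight up to lower
    degree. [R] must exceed the mode numbers in a monomial expression of [x], hence the bound
    [R0]. *)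
Lemma number_op_triangular f x : fock f x ->
  exists R0 : nat, forall R, (R0 <= R)%N -> fock (f - 1) (number_op R x - f%:~R *: x).
Proof.
elim=> {f x} [f x f0 hx|f|f a x y _ [R1 h1] _ [R2 h2]|f g b s x hb hx [R0 IH] fg].
(* A vector of the line viewed in degree f > 0 already has degree 0 <= f - 1, which absorbs f x. *)
- exists 0 => R _; rewrite number_op_line // sub0r; apply: (subspaceN (fock_sub _)).
  have [->|fn0] := eqVneq f 0; first by rewrite scale0r; apply: filt_0.
  by apply: (subspaceZ (fock_sub _)); apply: filt_base => //; lia.
- by exists 0 => R _; rewrite (lin0 (number_op_lin _)) scaler0 subr0; apply: filt_0.
- exists (maxn R1 R2) => R; rewrite geq_max => /andP[r1 r2].
  rewrite number_op_lin scalerDr scalerA mulrC -scalerA opprD addrACA -scalerBr.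
  by apply: filt_lin; [apply: h1|apply: h2].
exists (maxn R0 `|s|.+1) => R; rewrite geq_max => /andP[r1 r2].
have hbx : fock (f + fock_wt b s) (act b s x) by apply: filt_act hb hx _.
(* If the bound g is not attained, both terms already lie in degree g - 1. *)
have [gE|gn] := eqVneq g (f + fock_wt b s); last first.
  have hg : f + fock_wt b s <= g - 1 by lia.
  apply: (subspaceB (fock_sub _)).
    by apply: filt_mono hg _; apply: number_op_fock.
  by apply: (subspaceZ (fock_sub _)); apply: filt_mono hg _.
have h1 := number_op_creation hx hb r2.
have h2 := fock_closed b s (IH R r1).
have -> : number_op R (act b s x) - g%:~R *: act b s x =
  (number_op R (act b s x) - act b s (number_op R x) - (fock_wt b s)%:~R *: act b s x)
  + act b s (number_op R x - f%:~R *: x).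
  rewrite (linB (aL _ _)) (linZ (aL _ _)) gE rmorphD scalerDl opprD.
  by rewrite [RHS]addrACA subrK; congr (_ + _); rewrite addrC.
apply: (subspaceD (fock_sub _)); first by apply: filt_mono h1; lia.
by apply: filt_mono h2; lia.
Qed.

(* A nonzero vector of minimal filtration degree in a submodule is killed by
   all annihilation operators, hence by the number operator, and so has
   degree 0. *)
Lemma fock_irreducible (U : superspace F) gact (j : U -> M) (T : M -> Prop) :
  is_induced k gact act j -> (forall u, exists f, fock f (j u)) ->
  subspace T -> (forall a r x, T x -> T (act a r x)) ->
  (exists2 x, T x & x <> 0) -> T w.
Proof.
move=> hI hj hT hact [x Tx x0].
have [f hf] : exists f, fock f x.
  by apply: (filt_exhaust hM _ _ line_lt0 line_eq0 hI hj);
    [apply: fock_wtD|apply: fock_wt_kappa].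
have [n hn] : exists n : nat, fock n%:Z x.
  by exists `|f|%N; apply: filt_mono hf; lia.
elim: n x Tx x0 hn {f hf} => [|n IH] x Tx x0 hx.
  have [c xE] := filt_le0 hM line_subspace hx (lexx 0).
  have c0 : c != 0 by apply: contra_notN x0 => /eqP c0; rewrite xE c0 scale0r.
  by rewrite -[w](scalerK c0) -xE; apply: (subspaceZ hT).
case: (EM (exists2 y, T y & y <> 0 /\ fock n%:Z y)) => [[y Ty [y0 hy]]|noy].
  exact: (IH y).
have small y : T y -> fock n%:Z y -> y = 0.
  by move=> Ty hy; apply: contrapT => y0; apply: noy; exists y.
have ann a r : fock_wt a r < 0 -> act a r x = 0.
  move=> wr; apply: small; first exact: hact.
  by apply: filt_mono (fock_closed a r hx); lia.
have num R : number_op R x = 0.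
  rewrite /number_op big1 // => i _; rewrite big1 // => a _.
  by rewrite /occupation; case: ifP => // wr; rewrite (ann _ _ wr) (lin0 (aL _ _)) scaler0.
have [R /(_ R (leqnn R))] := number_op_triangular hx.
rewrite num sub0r => h; exfalso; apply: x0.
have : - (n.+1%:Z%:~R *: x) = 0.
  apply: small; first by apply: (subspaceN hT); apply: (subspaceZ hT).
  by apply: filt_mono h; lia.
move/eqP; rewrite oppr_eq0 scaler_eq0 intr_eq0 /= => /eqP; exact.
Qed.

End Fock.

(** * The affine and Virasoro modes of a module *)

Lemma gbin_0 (F : numFieldType) (m : int) : gbin F m 0 = 1.
Proof. by rewrite /gbin big_ord0 fact0 divr1. Qed.

Lemma gbin_1 (F : numFieldType) (m : int) : gbin F m 1 = m%:~R.
Proof. by rewrite /gbin big_ord1 (_ : 1`! = 1)%N // divr1 subr0. Qed.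

Lemma gbin_small (F : numFieldType) (m j : nat) : (m < j)%N -> gbin F m%:Z j = 0.
Proof.
by move=> mj; rewrite /gbin (bigD1 (Ordinal mj)) //= subrr !mul0r.
Qed.

Lemma gbin_N1 (F : numFieldType) (j : nat) : gbin F (-1) j = (-1) ^+ j.
Proof.
rewrite /gbin; have -> : \prod_(i < j) ((-1)%:~R - (i : nat)%:R) = (-1) ^+ j * (j`!)%:R :> F.
  elim: j => [|j IH]; first by rewrite big_ord0 fact0 mulr1.
  rewrite big_ord_recr IH /= factS natrM exprS -natr1 mulrN1z.
  by ring.
by rewrite mulfK // pnatr_eq0 -lt0n fact_gt0.
Qed.

Lemma sum_ord_eq1 (F : numFieldType) (M : lmodType F) (f : nat -> M) J :
  (1 <= J)%N -> (forall j, (1 <= j)%N -> f j = 0) -> \sum_(j < J) f j = f 0%N.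
Proof.
case: J => // J _ h; rewrite big_ord_recl big1 ?addr0 // => i _; exact: h.
Qed.

Lemma sum_ord_eq2 (F : numFieldType) (M : lmodType F) (f : nat -> M) J :
  (2 <= J)%N -> (forall j, (2 <= j)%N -> f j = 0) ->
  \sum_(j < J) f j = f 0%N + f 1%N.
Proof.
case: J => [|[|J]] // _ h; rewrite !big_ord_recl big1 ?addr0 // => i _; exact: h.
Qed.

Section Fields.
Variables (F : numFieldType) (V : vosa F) (W : superspace F).
Variable (Y : V -> int -> W -> W).
Hypothesis hY : vertex_operator_map Y.
Hypothesis hJ : jacobi_identity (@vosa_Y F V) Y.

Lemma field_lin v n : is_linear (Y v n).
Proof. by case: hY. Qed.

Lemma field_linl n w : is_linear (fun v => Y v n w).
Proof. by case: hY. Qed.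

Lemma commutator_formula p q u v w (m l : int) : homog p u -> homog q v ->
  (forall j : nat, (2 <= j)%N -> gbin F m j = 0 \/ vosa_Y u j%:Z v = 0) ->
  Y u m (Y v l w) = (-1) ^+ (p && q) *: Y v l (Y u m w)
    + (Y (vosa_Y u 0 v) (m + l) w + m%:~R *: Y (vosa_Y u 1 v) (m + l - 1) w).
Proof.
move=> hu hv h2; have [J0 /(_ (maxn J0 2)) HJ] := hJ w l m 0 hu hv.
move: HJ; rewrite leq_maxl => /(_ isT).
have Jge : (2 <= maxn J0 2)%N by rewrite leq_maxr.
move: (maxn J0 2) Jge => J J2.
rewrite (sum_ord_eq2 (f := fun j => gbin F m j *: Y (vosa_Y u (0 + j%:Z) v) (m + l - j%:Z) w)) //.
  rewrite (sum_ord_eq1 (f := fun j => ((-1) ^+ j * gbin F 0 j) *: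
          (Y u (m + 0 - j%:Z) (Y v (l + j%:Z) w)
           - ((-1) ^ 0 * (-1) ^+ (p && q)) *:
               Y v (0 + l - j%:Z) (Y u (m + j%:Z) w)))) //; last 2 first.
    exact: ltnW.
    by move=> j j1; rewrite (gbin_small F (m := 0)) // mulr0 scale0r.
  rewrite !gbin_0 gbin_1 expr0 expr0z !mul1r !scale1r.
  rewrite -[Posz 0]/(0 : int) -[Posz 1]/(1 : int) !subr0 ?addr0 !add0r => ->.
  by rewrite addrC subrK.
move=> j j2; rewrite add0r; have [->|->] := h2 j j2; first by rewrite scale0r.
by rewrite (lin0 (field_linl _ _)) scaler0.
Qed.

Definition iterate_term p q (u v : V) (n l : int) (w : W) (j : nat) : W :=
  ((-1) ^+ j * gbin F n j) *:
     (Y u (n - j%:Z) (Y v (l + j%:Z) w)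
      - ((-1) ^ n * (-1) ^+ (p && q)) *: Y v (n + l - j%:Z) (Y u j%:Z w)).

(** The Jacobi identity with m = 0, which collapses its left side. It expresses the field of u_n v
    through those of u and v. *)
Lemma iterate_formula p q u v w (n l : int) : homog p u -> homog q v ->
  exists J0, forall J, (J0 <= J)%N ->
    Y (vosa_Y u n v) l w = \sum_(j < J) iterate_term p q u v n l w j.
Proof.
move=> hu hv; have [J0 HJ] := hJ w l 0 n hu hv.
exists (maxn J0 1) => J; rewrite geq_max => /andP[J0J J1].
move: (HJ J J0J).
rewrite (sum_ord_eq1 (f := fun j => gbin F 0 j *: Y (vosa_Y u (n + j%:Z) v) (0 + l - j%:Z) w)) //.
  rewrite gbin_0 scale1r add0r !subr0 ?addr0 => ->.
  by apply: eq_bigr => j _; rewrite /iterate_term !add0r.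
by move=> j j1; rewrite (gbin_small F (m := 0)) // scale0r.
Qed.

End Fields.

(** * Generators and conformal vector of the affine vertex superalgebra *)

Section AffineVosa.
Variables (F : numFieldType) (k : F) (V : vosa F) (gen : gl11 -> V).
Hypothesis hV : is_affine_vosa k gen.

Local Notation one := (vacuum V).
Local Notation act a r := (vosa_Y (gen a) r).
Local Notation om := (conformal V).

Lemma gen_homog a : homog (gl_par a) (gen a).
Proof. by case: hV => h _ _; apply: h. Qed.

Lemma vosa_affine : is_affine_module k (fun a r (v : V) => act a r v).
Proof. by case: hV => _ [h _ _] _; apply: h. Qed.

Lemma gen_vacuum a : act a (-1) one = gen a.
Proof. by have [h _] := vosa_creation (gen a). Qed.

Lemma gen_vacuum_ge0 a r : 0 <= r -> act a r one = 0.
Proof. by move=> r0; have [_ h] := vosa_creation (gen a); apply: h. Qed.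

Lemma gen_gen a b (j : nat) :
  act a j%:Z (gen b) = gl_comb (gl_br F a b) (fun c => act c (j%:Z - 1) one)
    + (j%:R * gl_kappa F a b * (j == 1)%:R * k) *: one.
Proof.
rewrite -[gen b]gen_vacuum (affine_swap _ _ _ _ _ vosa_affine).
rewrite gen_vacuum_ge0 // (lin0 (affine_lin _ _ vosa_affine)) scaler0 add0r.
by rewrite subr_eq0.
Qed.

Lemma gen_gen0 a b : act a 0 (gen b) = gl_comb (gl_br F a b) gen.
Proof.
rewrite (gen_gen a b 0) !mul0r scale0r addr0; apply: eq_gl_comb => c _.
by rewrite sub0r gen_vacuum.
Qed.

Lemma gen_gen1 a b : act a 1 (gen b) = (gl_kappa F a b * k) *: one.
Proof.
rewrite (gen_gen a b 1) mul1r mulr1 gl_comb0 ?add0r // => c _.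
by rewrite subrr gen_vacuum_ge0.
Qed.

Lemma gen_gen2 a b (j : nat) : (2 <= j)%N -> act a j%:Z (gen b) = 0.
Proof.
move=> j2; rewrite gen_gen gl_comb0 ?add0r.
  by rewrite (gtn_eqF (j2 : (1 < j)%N)) mulr0 mul0r scale0r.
by move=> c _; rewrite gen_vacuum_ge0 //; lia.
Qed.

Section Module.
Variables (W : superspace F) (Y : V -> int -> W -> W).
Hypothesis hY : vertex_operator_map Y.
Hypothesis hJ : jacobi_identity (@vosa_Y F V) Y.
Hypothesis hY1 : forall n w, Y one n w = if n == -1 then w else 0.

Local Notation yact a r := (Y (gen a) r).

Lemma module_affine : is_affine_module k (fun a r w => yact a r w).
Proof.
split=> [a r|a r|a b r s x]; first exact: field_lin.
  by case: hY => _ _ h _; apply: h; apply: gen_homog.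
rewrite (commutator_formula hY hJ x s (gen_homog a) (gen_homog b)); last first.
  by move=> j j2; right; apply: gen_gen2.
rewrite addrAC subrr add0r gen_gen0 gen_gen1 (lin_comb _ _ (field_linl hY _ _)).
congr (_ + _); rewrite (linZ (field_linl hY _ _)) hY1 scalerA.
rewrite -subr_eq0 opprK addrNK.
by case: eqP => _; rewrite ?mulr1 ?mulr0 ?mul0r ?scale0r ?scaler0 // mulrA.
Qed.

(** Mode 1 of the conformal vector is L_0, so each of its summands has this shape. For n = -1 the
    binomials cancel the signs in the iterate formula, and the hypothesis on [w] cuts the sum to j
    <= 1. *)
Lemma quadratic_mode a b w :
  (forall c (r : int), 2 <= r -> yact c r w = 0) ->
  Y (act a (-1) (gen b)) 1 w = yact a (-1) (yact b 1 w)
    + (-1) ^+ (gl_par a && gl_par b) *: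
        (yact b 0 (yact a 0 w) + yact b (-1) (yact a 1 w)).
Proof.
move=> h; have [J0 HJ] := iterate_formula hJ w (-1) 1 (gen_homog a) (gen_homog b).
rewrite (HJ (maxn J0 2)) ?leq_maxl //.
have E j : iterate_term Y (gl_par a) (gl_par b) (gen a) (gen b) (-1) 1 w j =
   yact a (-1 - j%:Z) (yact b (1 + j%:Z) w)
   + (-1) ^+ (gl_par a && gl_par b) *: yact b (- j%:Z) (yact a j%:Z w).
  rewrite /iterate_term gbin_N1 -expr2 sqrr_sign scale1r addNr sub0r.
  by rewrite exprN1 invrN1 mulN1r scaleNr opprK.
rewrite sum_ord_eq2 ?leq_maxr //.
  rewrite !E subr0 addr0 oppr0 (h b (1 + 1%:Z)) // (lin0 (field_lin hY _ _)) add0r.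
  by rewrite scalerDr addrA.
move=> j j2; rewrite E !h ?(lin0 (field_lin hY _ _)) ?scaler0 ?addr0 //; lia.
Qed.

Lemma conformal_mode w n : Y om n w =
  (2%:R * k)^-1 *:
    (Y (act gN (-1) (gen gE)) n w + Y (act gE (-1) (gen gN)) n w
     - Y (act psi_p (-1) (gen psi_m)) n w + Y (act psi_m (-1) (gen psi_p)) n w)
  + (2%:R * k ^+ 2)^-1 *: Y (act gE (-1) (gen gE)) n w.
Proof.
case: hV => _ _ ->; rewrite !gen_vacuum.
have h := field_linl hY n w.
by rewrite (linD h) !(linZ h) (linD h) (linB h) (linD h).
Qed.

(** On a highest-weight vector only zero modes survive in the Sugawara formula, and psi^+_0 psi^-_0
    acts by e. The eigenvalue stays implicit: [Vhat_levels] only counts upwards from it. *)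
Lemma L0_hw e nu y : is_hw (fun a r => yact a r) nu e y ->
  exists c, Y om 1 y = c *: y.
Proof.
move=> [hN hE hp hr].
have h c (r : int) : 1 <= r -> yact c r y = 0 by move=> r1; apply: hr; lia.
have lin a r := field_lin hY (gen a) r.
have hm : yact psi_p 0 (yact psi_m 0 y) = e *: y.
  rewrite (affine_swap psi_p psi_m 0 0 y module_affine) hp (lin0 (lin _ _)).
  by rewrite scaler0 add0r /gl_comb /= !scale0r !mul0r scale0r scale1r add0r !addr0 hE.
rewrite conformal_mode !quadratic_mode => [|c r r2|c r r2|c r r2|c r r2|c r r2]; try by apply: h; lia.
rewrite !(h _ 1) // !(lin0 (lin _ _)) !add0r !addr0 /= !expr0 !expr1 !scale1r !scaleN1r.
rewrite hm hp hN hE !(linZ (lin _ _)) hN hE (lin0 (lin _ _)) oppr0 subr0 !scalerA.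
rewrite -!scalerDl -scalerBl !scalerA -!scalerDl.
by eexists.
Qed.

End Module.

Hypothesis hk : k != 0.

Lemma L0_gen c : vosa_Y om 1 (gen c) = gen c.
Proof.
have Vf := vosa_fields V; have Vj := @vosa_jacobi F V.
have h a b (r : int) : 2 <= r -> act a r (gen b) = 0.
  by move=> r2; have -> : r = `|r|%N by [lia]; rewrite gen_gen2 //; lia.
have lin a r := field_lin Vf (gen a) r.
have h0 a b : act a 0 (act b 0 (gen c)) =
    gl_comb (gl_br F b c) (fun d => gl_comb (gl_br F a d) gen).
  by rewrite gen_gen0 (lin_comb _ _ (lin _ _)); apply: eq_gl_comb => d _; rewrite gen_gen0.
rewrite (conformal_mode Vf) !(quadratic_mode Vf Vj) => [|d r|d r|d r|d r|d r]; try exact: h.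
rewrite !h0 !gen_gen1 !(linZ (lin _ _)) !gen_vacuum.
have k2 : 2%:R * k != 0 by rewrite mulf_neq0 // pnatr_eq0.
case: c {h0}; rewrite /gl_comb /= !scale0r !mul0r ?scale0r !addr0 ?add0r ?scale1r
   ?expr0 ?expr1 ?mul1r ?scale1r ?scaleN1r.
- have tw (v : V) : v + v = 2%:R *: v by rewrite scaler_nat mulr2n.
  rewrite addr0 opprK -addrA -opprD !tw scalerBr !scalerA.
  rewrite -addrA -scaleNr -scalerDl [X in X *: _ + _ = _](_ : _ = 1); last by field.
  by rewrite [X in _ + X *: _](_ : _ = 0) ?scale1r ?scale0r ?addr0 //; field.
- rewrite oppr0 !subr0 !addr0 scaler0 addr0 -scalerDl scalerA.
  by rewrite [X in X *: _](_ : _ = 1) ?scale1r //; field.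
- rewrite subr0 !add0r scaler0 addr0 -opprD -scalerDl -scaleNr scalerA.
  by rewrite [X in X *: _](_ : _ = 1) ?scale1r //; field.
- rewrite oppr0 opprK scaler0 !addr0 !add0r -scalerDl scalerA.
  by rewrite [X in X *: _](_ : _ = 1) ?scale1r //; field.
Qed.

Section Module.
Variables (W : superspace F) (Y : V -> int -> W -> W).
Hypothesis hY : vertex_operator_map Y.
Hypothesis hJ : jacobi_identity (@vosa_Y F V) Y.
Hypothesis hYd : forall v n w,
    Y (vir (@vosa_Y F V) om (-1) v) n w = - n%:~R *: Y v (n - 1) w.

(** With m = 1 the commutator formula stops at L_{-1} and L_0: the derivative contributes -(1 + r)
    and the conformal weight contributes 1. *)
Lemma L0_commutator a r x :
  Y om 1 (Y (gen a) r x) = Y (gen a) r (Y om 1 x) - r%:~R *: Y (gen a) r x.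
Proof.
rewrite (commutator_formula hY hJ x r (conformal_even V) (gen_homog a)); last first.
  by move=> j j2; left; rewrite (gbin_small F (m := 1)).
rewrite andFb expr0 scale1r; congr (_ + _).
rewrite L0_gen; have := hYd (gen a) (1 + r) x; rewrite /vir addNr => ->.
rewrite [1 + r]addrC addrK scale1r rmorphD opprD scalerDl scaleN1r.
by rewrite scaleNr subrK.
Qed.

End Module.
End AffineVosa.

(** * From affine maps to module morphisms *)

Lemma homog_morphism_of_affine (F : numFieldType) (k : F) (V : vosa F)
    (gen : gl11 -> V) (M N : vmodule V) (p : bool) (g : M -> N) :
  is_affine_vosa k gen -> is_linear g -> has_parity p g ->
  (forall a r x, g (aff_act gen a r x)
     = (-1) ^+ (p && gl_par a) *: aff_act gen a r (g x)) ->
  homog_morphism p g.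
Proof.
move=> hV gl gp hg; split => // q v n x hv.
have [hgen hI _] := hV.
pose C q (v : V) := forall n x, g (mod_Y v n x) = (-1) ^+ (p && q) *: mod_Y v n (g x).
have Clin q' : subspace (C q').
  have lY (M' : vmodule V) n x := field_linl (mod_fields M') n x.
  split=> [m y|c u u' hu hu' m y].
    by rewrite !(lin0 (lY _ _ _)) (lin0 gl) scaler0.
  by rewrite !(lY _ _ _ c u u') gl hu hu' scalerDr !scalerA mulrC.
(* The sign depends on the parity of the vector, so generation from the vacuum is applied to sums of
   an even and an odd vector whose modes satisfy the sign rule. The iterate formula keeps this set
   stable under the generators. *)
pose S v := exists v0 v1 : V,
  [/\ homog false v0, homog true v1, C false v0, C true v1 & v = v0 + v1].
have H0 q' : homog q' (0 : V) by apply: (homog_subspace V q').1.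
have one q' v' : homog q' v' -> C q' v' -> S v'.
  case: q' => h1 h2.
    by exists 0, v'; rewrite add0r; split => //; apply: (Clin false).1.
  by exists v', 0; rewrite addr0; split => //; apply: (Clin true).1.
have step a r q' v' : homog q' v' -> C q' v' -> C (gl_par a (+) q') (vosa_Y (gen a) r v').
  move=> hv' Cv' m y.
  have [J1 h1] := iterate_formula (@mod_jacobi F V M) y r m (hgen a) hv'.
  have [J2 h2] := iterate_formula (@mod_jacobi F V N) (g y) r m (hgen a) hv'.
  rewrite (h1 (maxn J1 J2)) ?leq_maxl // (h2 (maxn J1 J2)) ?leq_maxr //.
  rewrite (lin_sum gl) scaler_sumr; apply: eq_bigr => j _.
  rewrite /iterate_term (linZ gl) [RHS]scalerA [X in _ = X *: _]mulrC -[RHS]scalerA.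
  congr (_ *: _).
  have sE : (-1) ^+ (p && (gl_par a (+) q')) = (-1) ^+ (p && gl_par a) * (-1) ^+ (p && q') :> F.
    by case: (p) (gl_par a) (q') => [] [] []; rewrite /= ?expr0 ?expr1; ring.
  have lM v n := field_lin (mod_fields M) v n.
  have lN v n := field_lin (mod_fields N) v n.
  rewrite (linB gl) (linZ gl) hg Cv' Cv' hg /aff_act !(linZ (lN _ _)) scalerBr !scalerA sE.
  move: ((-1) ^+ (p && gl_par a)) ((-1) ^+ (p && q')) ((-1) ^+ (gl_par a && q')) ((-1) ^ r).
  move=> s1 s2 s3 s4.
  by congr (_ *: _ - _ *: _); ring.
have SS : subspace S.
  split; first by apply: (one false) => //; apply: (Clin false).1.
  move=> c _ _ [y [z [hy hz sy sz ->]]] [y' [z' [hy' hz' sy' sz' ->]]].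
  exists (c *: y + y'), (c *: z + z'); split; last by rewrite scalerDr addrACA.
  + exact: homog_lin.
  + exact: homog_lin.
  + exact: (Clin false).2.
  + exact: (Clin true).2.
have [v0 [v1 [h0 h1 c0 c1 vE]]] : S v.
  apply: (induced_generated hI) => // [a r _ [y [z [hy hz sy sz ->]]]|c].
    rewrite (linD (field_lin (vosa_fields V) _ _)); apply: (subspaceD SS).
      by apply: one (step a r false y hy sy); apply: (affine_par a r (vosa_affine hV)).
    by apply: one (step a r true z hz sz); apply: (affine_par a r (vosa_affine hV)).
  apply: (subspaceZ SS); apply: (one false); first exact: vacuum_even.
  move=> m y; rewrite !mod_vacuum andbF expr0 scale1r.
  by case: ifP => // _; rewrite (lin0 gl).
rewrite vE in hv *; case: q hv => hv.
  have [-> _] := homog_split_eq hv (H0 false) h1 h0 (etrans (addr0 _) (addrC _ _)).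
  exact: c1.
have [-> _] := homog_split_eq hv (H0 true) h0 h1 (addr0 _).
exact: c0.
Qed.

(** * Correcting a vector to a highest-weight vector *)

Section Extremal.
Variables (F : numFieldType) (k e : F) (M : superspace F).
Variable (act : gl11 -> int -> M -> M).
Hypothesis hM : is_affine_module k act.
Hypothesis hk : k != 0.
Hypothesis he : forall z : int, e + z%:~R * k != 0.

Let aL a r := affine_lin a r hM.

Lemma mode_swap0 a b r s x :
  gl_kappa F a b = 0 \/ r + s <> 0 \/ r = 0 ->
  act a r (act b s x) = (-1) ^+ (gl_par a && gl_par b) *: act b s (act a r x)
    + gl_comb (gl_br F a b) (fun c => act c (r + s) x).
Proof.
move=> h; rewrite (affine_swap _ _ _ _ _ hM); congr (_ + _).
suff -> : r%:~R * gl_kappa F a b * (r + s == 0)%:R * k = 0 by rewrite scale0r addr0.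
case: h => [->|[h|->]]; rewrite ?mulr0 ?mul0r //.
by have /negPf -> : r + s != 0 by [apply/eqP]; rewrite mulr0 mul0r.
Qed.

Ltac mode_comm := rewrite mode_swap0 ?/gl_comb /= ?scale0r ?add0r ?addr0
  ?expr0 ?expr1 ?scale1r ?scaleN1r ?add0r ?addr0.

Lemma E_E r s x : act gE r (act gE s x) = act gE s (act gE r x).
Proof. by mode_comm => //; left. Qed.

Lemma E_psi_p r s x : act gE r (act psi_p s x) = act psi_p s (act gE r x).
Proof. by mode_comm => //; left. Qed.

Lemma E_psi_m r s x : act gE r (act psi_m s x) = act psi_m s (act gE r x).
Proof. by mode_comm => //; left. Qed.

Lemma E_N r s x : r + s <> 0 -> act gE r (act gN s x) = act gN s (act gE r x).
Proof. by move=> rs; mode_comm => //; right; left. Qed.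

Lemma N_N r s x : act gN r (act gN s x) = act gN s (act gN r x).
Proof. by mode_comm => //; left. Qed.

Lemma psi_p_psi_p r s x : act psi_p r (act psi_p s x) = - act psi_p s (act psi_p r x).
Proof. by mode_comm => //; left. Qed.

Lemma psi_m_psi_m r s x : act psi_m r (act psi_m s x) = - act psi_m s (act psi_m r x).
Proof. by mode_comm => //; left. Qed.

Lemma psi_p_psi_m r s x : r + s <> 0 ->
  act psi_p r (act psi_m s x) = - act psi_m s (act psi_p r x) + act gE (r + s) x.
Proof. by move=> rs; mode_comm => //; right; left. Qed.

Lemma psi_p_N r s x :
  act psi_p r (act gN s x) = act gN s (act psi_p r x) - act psi_p (r + s) x.
Proof. by mode_comm => //; left. Qed.

Lemma psi_m_N r s x :
  act psi_m r (act gN s x) = act gN s (act psi_m r x) + act psi_m (r + s) x.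
Proof. by mode_comm => //; left. Qed.

Lemma E0_central a r x : act gE 0 (act a r x) = act a r (act gE 0 x).
Proof. by case: a; mode_comm => //; right; right. Qed.

Lemma N0_weight a r x : act gN 0 (act a r x) =
  act a r (act gN 0 x) + gl_br F gN a a *: act a r x.
Proof.
rewrite mode_swap0 /=; last by right; right.
rewrite expr0 scale1r add0r /gl_comb; congr (_ + _).
by case: a; rewrite /= !scale0r ?add0r ?addr0.
Qed.

(** From A B - B A = c with c nonzero, A^(m+1) B A x = B A^(m+2) x + (m+1) c A^(m+1) x. So if
    A^(m+2) x = 0, subtracting B A x / ((m+1) c) lowers the order of nilpotency by one, and [P]
    survives each such correction. *)
Lemma heisenberg_kill a r (P : M -> Prop) x :
  ~~ gl_par a -> 0 < r ->
  (forall c y, P y -> P (y + c *: act (dual_gen a) (- r) (act a r y))) ->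
  (exists m, iter m (act a r) x = 0) -> P x -> exists y, P y /\ act a r y = 0.
Proof.
move=> ha r0 hP [m hm] Px; set A := act a r; set B := act (dual_gen a) (- r).
have lA : is_linear A by apply: aL.
have lB : is_linear B by apply: aL.
pose c : F := r%:~R * k.
have c0 : c != 0 by rewrite mulf_neq0 // intr_eq0; lia.
have AB z : A (B z) = B (A z) + c *: z.
  rewrite /A /B (affine_swap _ _ _ _ _ hM) subrr eqxx mulr1.
  by rewrite /c; case: (a) ha => //= _; rewrite expr0 scale1r mulr1 /gl_comb /= !scale0r !add0r.
have ABn n z : iter n.+1 A (B z) = B (iter n.+1 A z) + (n.+1%:R * c) *: iter n A z.
  elim: n => [|n IH]; first by rewrite /= AB mul1r.
  rewrite iterS IH (linD lA) (linZ lA) AB -iterS -addrA -scalerDl.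
  by congr (_ + _ *: _); rewrite -[in RHS]natr1 mulrDl mul1r addrC.
have itL n : is_linear (iter n A).
  by elim: n => [|n IH] y z t //=; rewrite IH lA.
have {hm} : iter m.+1 A x = 0 by rewrite iterS hm (lin0 lA).
elim: m x Px => [|m IH] x Px hx; first by exists x.
apply: (IH (x + (- (m.+1%:R * c)^-1) *: B (A x))); first exact: hP.
have d0 : m.+1%:R * c != 0 by rewrite mulf_neq0 // pnatr_eq0.
rewrite (linD (itL _)) (linZ (itL _)) ABn -iterSr hx (lin0 lB) add0r.
by rewrite scalerA mulNr mulVf // scaleN1r -iterSr subrr.
Qed.

(** One correction suffices because A = a_r squares to zero: with B the dual mode, A B A x = d A x
    for a nonzero scalar d. *)
Lemma fermion_kill a r x : gl_par a -> act gE 0 x = e *: x ->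
  exists c, act a r (x + c *: act (dual_gen a) (- r) (act a r x)) = 0.
Proof.
move=> ha hE; set y := act a r x.
pose d : F := e + r%:~R * gl_kappa F a (dual_gen a) * k.
have d0 : d != 0.
  rewrite /d; case: (a) ha => //= _; first by rewrite mulr1 he.
  by rewrite mulrN1 -rmorphN he.
have aa : act a r y = 0.
  have h : act a r y + act a r y = 0.
    by rewrite /y; case: (a) ha => //= _; [rewrite {1}psi_p_psi_p|rewrite {1}psi_m_psi_m];
      rewrite addNr.
  have : (2%:R : F) *: act a r y = 0 by rewrite scaler_nat mulr2n.
  by move/eqP; rewrite scaler_eq0 pnatr_eq0 /= => /eqP.
have hEy : act gE 0 y = e *: y.
  by rewrite /y; case: (a) ha => //= _; rewrite ?E_psi_p ?E_psi_m hE (linZ (aL _ _)).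
exists (- d^-1); rewrite (linD (aL _ _)) (linZ (aL _ _)) (affine_swap _ _ _ _ _ hM).
rewrite aa (lin0 (aL _ _)) scaler0 add0r subrr eqxx mulr1.
have -> : gl_comb (gl_br F a (dual_gen a)) (fun c => act c 0 y)
    + (r%:~R * gl_kappa F a (dual_gen a) * k) *: y = d *: y.
  rewrite /d scalerDl; congr (_ + _); rewrite -hEy /gl_comb.
  by case: (a) ha => //= _; rewrite !scale0r scale1r !addr0 add0r.
by rewrite scalerA mulNr mulVf // scaleN1r subrr.
Qed.

(** What every correction must keep. In [hw_lift] it says that the vector maps to a given
    highest-weight vector and that E_0 acts on it by e; a correction has an annihilation operator
    innermost, so it dies in the image. *)
Variable R : M -> Prop.
Hypothesis RE : forall x, R x -> act gE 0 x = e *: x.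
Hypothesis Rstep : forall a r c x, 0 < r \/ (a = psi_p /\ r = 0) ->
  R x -> R (x + c *: act (dual_gen a) (- r) (act a r x)).
Hypothesis truncated : forall x, exists n : nat,
  forall a (r : int), n%:Z <= r -> act a r x = 0.
Hypothesis nilpotent : forall a r x, ~~ gl_par a -> 0 < r ->
  exists m, iter m (act a r) x = 0.

Lemma descend (P : nat -> M -> Prop) n x :
  P n x -> (forall n x, P n.+1 x -> exists y, P n y) -> exists y, P 0%N y.
Proof. by move=> + h; elim: n x => [|n IH] x; [exists x|move/h => [y /IH]]. Qed.

(** The order E, psi^+, psi^-, N, each from high modes to low ones, makes the brackets met by a
    later correction end in modes already killed: two fermions give a mode of E, and a fermion with
    N gives a mode of that fermion. *)
Lemma kill_E : (exists x, R x) ->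
  exists x, R x /\ forall s, 0 < s -> act gE s x = 0.
Proof.
move=> [x Rx]; have [n hn] := truncated x.
apply: (@descend (fun n x => R x /\ forall s, n%:Z < s -> act gE s x = 0) n x).
  by split => // s hs; apply: hn; lia.
move=> {n x Rx hn} n x [Rx hx].
pose P (y : M) := R y /\ forall s, n.+1%:Z < s -> act gE s y = 0.
have hP c y : P y -> P (y + c *: act gN (- n.+1%:Z) (act gE n.+1 y)).
  move=> [Ry hy]; split => [|s hs]; first by apply: (@Rstep gE) => //; left.
  rewrite (linD (aL _ _)) (linZ (aL _ _)) hy //= E_N; last by lia.
  by rewrite E_E hy // !(lin0 (aL _ _)) scaler0 addr0.
have [y [[Ry hy] y0]] := @heisenberg_kill gE n.+1 P x isT isT hP
  (@nilpotent gE n.+1 x isT isT) (conj Rx hx).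
exists y; split => // s hs; case: (eqVneq s n.+1) => [->//|sn].
by apply: hy; lia.
Qed.

Lemma kill_psi_p : (exists x, R x) -> exists x,
  [/\ R x, forall s, 0 < s -> act gE s x = 0 & forall s, 0 <= s -> act psi_p s x = 0].
Proof.
move=> /kill_E[x [Rx hE]]; have [n hn] := truncated x.
have [|m z [Rx' hE' hp]|y [Ry hEy hy]] := @descend (fun n x =>
   [/\ R x, forall s, 0 < s -> act gE s x = 0 & forall s, n%:Z <= s -> act psi_p s x = 0]) n x.
- by split => // s hs; apply: hn; lia.
- have [c hc] := fermion_kill (a := psi_p) m%:Z isT (RE Rx').
  exists (z + c *: act psi_m (- m%:Z) (act psi_p m z)); split => [|s hs|s hs].
  (* The descent reaches m = 0, the annihilation operator psi^+_0, whose norm is e itself. *)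
  + by apply: (@Rstep psi_p) => //; case: (m) => [|i]; [right|left].
  + rewrite (linD (aL _ _)) (linZ (aL _ _)) hE' // E_psi_m E_psi_p hE' //.
    by rewrite !(lin0 (aL _ _)) scaler0 addr0.
  + have [->|sm] := eqVneq s m; first exact: hc.
    rewrite (linD (aL _ _)) (linZ (aL _ _)) hp; last by lia.
    (* Here s > m, so the bracket is E_{s-m}, a positive mode of E. *)
    rewrite psi_p_psi_m; last by move/eqP: sm; lia.
    rewrite psi_p_psi_p hp; last by lia.
    rewrite E_psi_p hE'; last by lia.
    by rewrite !(lin0 (aL _ _)) !oppr0 !(lin0 (aL _ _)) addr0 oppr0 scaler0 addr0.
- by exists y.
Qed.

Lemma kill_psi : (exists x, R x) -> exists x,
  [/\ R x, forall s, 0 < s -> act gE s x = 0, forall s, 0 <= s -> act psi_p s x = 0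
    & forall s, 0 < s -> act psi_m s x = 0].
Proof.
move=> /kill_psi_p[x [Rx hE hp]]; have [n hn] := truncated x.
have [|m z [Rx' hE' hp' hm]|y [Ry hEy hpy hy]] := @descend (fun n x =>
   [/\ R x, forall s, 0 < s -> act gE s x = 0, forall s, 0 <= s -> act psi_p s x = 0
     & forall s, n%:Z < s -> act psi_m s x = 0]) n x.
- by split => // s hs; apply: hn; lia.
- have [c hc] := fermion_kill (a := psi_m) m.+1%:Z isT (RE Rx').
  exists (z + c *: act psi_p (- m.+1%:Z) (act psi_m m.+1 z)); split => [|s hs|s hs|s hs].
  + by apply: (@Rstep psi_m) => //; left.
  + rewrite (linD (aL _ _)) (linZ (aL _ _)) hE' // E_psi_p E_psi_m hE' //.
    by rewrite !(lin0 (aL _ _)) scaler0 addr0.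
  + rewrite (linD (aL _ _)) (linZ (aL _ _)) hp' // psi_p_psi_p psi_p_psi_m; last by lia.
    rewrite hp' // hE'; last by lia.
    by rewrite (lin0 (aL _ _)) oppr0 addr0 (lin0 (aL _ _)) oppr0 scaler0 addr0.
  + have [->|sm] := eqVneq s m.+1; first exact: hc.
    rewrite (linD (aL _ _)) (linZ (aL _ _)) hm; last by lia.
    have := psi_p_psi_m (r := - m.+1%:Z) (s := s) (act psi_m m.+1 z).
    rewrite psi_m_psi_m hm ?(lin0 (aL _ _)) ?oppr0 ?(lin0 (aL _ _)); last by lia.
    rewrite E_psi_m hE'; last by lia.
    rewrite (lin0 (aL _ _)) addr0 => h.
    have /eqP := h ltac:(move/eqP: sm; lia).
    by rewrite eq_sym oppr_eq0 => /eqP ->; rewrite scaler0 addr0.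
- by exists y.
Qed.

Lemma kill_all : (exists x, R x) -> exists x,
  [/\ R x, act psi_p 0 x = 0 & forall a r, 0 < r -> act a r x = 0].
Proof.
move=> /kill_psi[x [Rx hE hp hm]]; have [n hn] := truncated x.
pose P n x := [/\ R x, forall s, 0 < s -> act gE s x = 0,
  forall s, 0 <= s -> act psi_p s x = 0, forall s, 0 < s -> act psi_m s x = 0
     & forall s, n < s -> act gN s x = 0].
have [||y [Ry hEy hpy hmy hNy]] := @descend (fun n => P n%:Z) n x.
- by split => // s hs; apply: hn; lia.
- move=> m z Pz.
  have hP c y : P m.+1 y -> P m.+1 (y + c *: act gE (- m.+1%:Z) (act gN m.+1 y)).
    move=> [Ry hEy hpy hmy hNy]; split => [|s hs|s hs|s hs|s hs].
    + by apply: (@Rstep gN) => //; left.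
    + rewrite (linD (aL _ _)) (linZ (aL _ _)) hEy //= E_E E_N; last by lia.
      by rewrite hEy // !(lin0 (aL _ _)) scaler0 addr0.
    + rewrite (linD (aL _ _)) (linZ (aL _ _)) hpy //= -E_psi_p psi_p_N !hpy //; last by lia.
      by rewrite !(lin0 (aL _ _)) subr0 (lin0 (aL _ _)) scaler0 addr0.
    + rewrite (linD (aL _ _)) (linZ (aL _ _)) hmy //= -E_psi_m psi_m_N !hmy //; last by lia.
      by rewrite !(lin0 (aL _ _)) addr0 (lin0 (aL _ _)) scaler0 addr0.
    + rewrite (linD (aL _ _)) (linZ (aL _ _)) hNy //= -E_N; last by lia.
      by rewrite N_N hNy // !(lin0 (aL _ _)) scaler0 addr0.
  have [y [[Ry hEy hpy hmy hNy] y0]] := @heisenberg_kill gN m.+1 (P m.+1) z isT isT hP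
    (@nilpotent gN m.+1 z isT isT) Pz.
  exists y; split => // s hs; case: (eqVneq s m.+1) => [->//|sn].
  by apply: hNy; lia.
exists y; split => // [|[] r r0]; [exact: hpy|exact: hNy|exact: hEy| |exact: hmy].
by apply: hpy; apply: ltW.
Qed.

End Extremal.

(** * Sums of eigenvectors *)

(** The pointwise form of [spanned_by_family] over any index type, so that levels can be indexed by
    natural numbers. *)
Definition family_sum (F : numFieldType) (M : lmodType F) (I : Type)
    (P : I -> M -> Prop) (x : M) : Prop :=
  exists s : seq (I * M),
    (forall u, List.In u s -> P u.1 u.2) /\ x = \sum_(u <- s) u.2.

Section FamilySum.
Variables (F : numFieldType) (M : lmodType F) (I : Type) (P : I -> M -> Prop).
Hypothesis hP : forall i, subspace (P i).

Lemma family_sum_subspace : subspace (family_sum P).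
Proof.
split; first by exists [::]; split => //; rewrite big_nil.
move=> a _ _ [s [hs ->]] [t [ht ->]].
exists ([seq (u.1, a *: u.2) | u <- s] ++ t); split.
  move=> u hu; case: (List.in_app_or _ _ _ hu); last exact: ht.
  move=> /(@List.in_map_iff _ _ _ _ _)[v [<- /hs hv]]; exact: subspaceZ.
by rewrite big_cat big_map scaler_sumr.
Qed.

Lemma family_sum1 i x : P i x -> family_sum P x.
Proof.
move=> h; exists [:: (i, x)]; split => [u [<-|//]//|].
by rewrite big_seq1.
Qed.

Lemma family_sum_ind (Q : M -> Prop) x : subspace Q ->
  (forall i y, P i y -> Q y) -> family_sum P x -> Q x.
Proof.
move=> hQ h [s [+ ->]]; elim: s => [|u s IH] hs.
  by rewrite big_nil; apply: hQ.1.
rewrite big_cons; apply: (subspaceD hQ); first by apply: (h u.1); apply: hs; left.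
by apply: IH => v hv; apply: hs; right.
Qed.

End FamilySum.

Lemma eigenvector_subspace (F : numFieldType) (M : lmodType F) (T : M -> M) h :
  is_linear T -> subspace (eigenvector T h).
Proof.
move=> hT; split; first by rewrite /eigenvector (lin0 hT) scaler0.
by move=> a x y hx hy; rewrite /eigenvector hT hx hy scalerDr !scalerA mulrC.
Qed.

(* Multiplying by the factors T - mu of a polynomial projector. *)
Lemma eigenvector_project (F : numFieldType) (M : lmodType F) (T : M -> M)
    (lam : F) (Q : M -> Prop) x :
  is_linear T ->
  (forall mu y, mu != lam -> Q y -> Q ((lam - mu)^-1 *: (T y - mu *: y))) ->
  family_sum (eigenvector T) x -> Q x -> exists y, Q y /\ T y = lam *: y.
Proof.
move=> hT hQ [s [hs xE]].
suff main m : forall s g x, size s = m ->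
    (forall u, List.In u s -> eigenvector T u.1 u.2) -> T g = lam *: g ->
    x = \sum_(u <- s) u.2 + g -> Q x -> exists y, Q y /\ T y = lam *: y.
  by apply: (main _ s 0 x erefl hs); rewrite ?addr0 // (lin0 hT) scaler0.
elim: m {s hs x xE} => [|m IH] s g x.
  by move=> /size0nil -> _ hg ->; rewrite big_nil add0r; exists g.
case: s => [//|[mu v] s] [sz] hs hg ->.
have hv : T v = mu *: v by apply: (hs (mu, v)); left.
have hs' u : List.In u s -> eigenvector T u.1 u.2 by move=> hu; apply: hs; right.
rewrite big_cons /=; have [muE|mun] := eqVneq mu lam.
  rewrite [v + _]addrC -addrA; apply: (IH s (v + g) _ sz hs') => //.
  by rewrite (linD hT) hv hg muE scalerDr.
move=> /(hQ _ _ mun).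
pose D y := (lam - mu)^-1 *: (T y - mu *: y).
have hD : is_linear D.
  by apply: is_linearZ; apply: is_linearB => //; apply: is_linearZ.
rewrite -/(D _).
have -> : D (v + \sum_(u <- s) u.2 + g) = \sum_(u <- [seq (u.1, D u.2) | u <- s]) u.2 + g.
  rewrite big_map (linD hD) (linD hD) (lin_sum hD) {1 3}/D hv hg subrr scaler0 add0r.
  by rewrite -scalerBl scalerA mulVf ?scale1r // subr_eq0 eq_sym.
apply: (IH _ g) => //; first by rewrite size_map.
move=> u /(@List.in_map_iff _ _ _ _ _)[u' [<- /hs' hu']].
have S := eigenvector_subspace u'.1 hT.
apply: (subspaceZ S); apply: (subspaceB S); last exact: (subspaceZ S).
by rewrite hu'; apply: (subspaceZ S).
Qed.

Lemma sub_swap (V : zmodType) (a b c d : V) : a - b - (c - d) = a - c - (b - d).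
Proof. by rewrite !opprB addrACA [RHS]addrACA [- b - c]addrC. Qed.

(* Applying T - mu i removes one summand and stays among the generalized
   eigenvectors for h, on which T - mu i is injective if mu i != h. *)
Lemma gen_eigenvector_family (F : numFieldType) (M : lmodType F) (T : M -> M)
    (I : Type) (mu : I -> F) (P : I -> M -> Prop) (h : F) (K : M -> Prop) x :
  is_linear T -> (forall i, subspace (P i)) ->
  (forall i y, P i y -> T y = mu i *: y) ->
  subspace K -> (forall y, K y -> T y = h *: y) ->
  (forall i y, P i y -> mu i = h -> K y) ->
  family_sum P x -> gen_eigenvector T h x -> K x.
Proof.
move=> hT hP PT hK KT PK [s [hs sE]].
pose E c y := T y - c *: y.
have hE c : is_linear (E c) by apply: is_linearB => //; apply: is_linearZ.
have hI n : is_linear (iter n (E h)).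
  by elim: n => [|n IHn] a y z //=; rewrite IHn hE.
have genE c y : gen_eigenvector T h y -> gen_eigenvector T h (E c y).
  move=> [n hn]; exists n; rewrite -/(E h).
  have -> : iter n (E h) (E c y) = E c (iter n (E h) y).
    elim: n {hn} => //= n ->; rewrite /E !(linB hT) !(linZ hT) !scalerBr !scalerA.
    by rewrite sub_swap [h * c]mulrC.
  by rewrite [iter _ _ _]hn (lin0 (hE c)).
have inj c y : c != h -> gen_eigenvector T h y -> T y = c *: y -> y = 0.
  move=> ch [n hn] hy; have : iter n (E h) y = (c - h) ^+ n *: y.
    elim: n {hn} => [|n IHn]; first by rewrite expr0 scale1r.
    by rewrite iterS IHn (linZ (hE h)) {1}/E hy -scalerBl scalerA -exprSr.
  rewrite [iter _ _ _]hn => /esym/eqP; rewrite scaler_eq0 expf_eq0 subr_eq0.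
  by rewrite (negPf ch) andbF => /eqP.
suff main m : forall s g x, size s = m ->
    (forall u, List.In u s -> P u.1 u.2) -> K g ->
    x = \sum_(u <- s) u.2 + g -> gen_eigenvector T h x -> K x.
  by apply: (main _ s 0 x erefl hs hK.1); rewrite addr0.
elim: m {s hs x sE} => [|m IH] s g x.
  by move=> /size0nil -> _ hg -> _; rewrite big_nil add0r.
case: s => [//|[i v] s] [sz] hs hg xE hx.
have hv : P i v by apply: (hs (i, v)); left.
have hs' u : List.In u s -> P u.1 u.2 by move=> hu; apply: hs; right.
move: xE; rewrite big_cons /=; have [muE|mun] := eqVneq (mu i) h.
  rewrite [v + _]addrC -addrA => xE; apply: (IH s (v + g) _ sz hs') xE hx.
  by apply: (subspaceD hK) => //; apply: PK muE.
move=> xE.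
have KEx : K (E (mu i) x).
  apply: (IH [seq (u.1, E (mu i) u.2) | u <- s] (E (mu i) g)).
  - by rewrite size_map.
  - move=> u /(@List.in_map_iff _ _ _ _ _)[u' [<- /hs' hu']] /=.
    rewrite /E (PT _ _ hu'); apply: (subspaceB (hP _)); exact: (subspaceZ (hP _)).
  - by rewrite /E (KT _ hg); apply: (subspaceB hK); apply: (subspaceZ hK).
  - rewrite big_map xE (linD (hE _)) (linD (hE _)) (lin_sum (hE _)).
    by rewrite {1}/E (PT _ _ hv) subrr add0r.
  - exact: genE.
have Tx : E h x = 0.
  apply: (inj (mu i)) => //; first exact: genE.
  apply/eqP; rewrite -subr_eq0; apply/eqP.
  have := KT _ KEx; rewrite /E !(linB hT) !(linZ hT) !scalerBr !scalerA [h * mu i]mulrC.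
  move/eqP; rewrite -subr_eq0 => /eqP <-; exact: sub_swap.
have xE' : x = (h - mu i)^-1 *: E (mu i) x.
  have -> : E (mu i) x = (h - mu i) *: x.
    by move/eqP: Tx; rewrite /E subr_eq0 => /eqP ->; rewrite -scalerBl.
  by rewrite scalerA mulVf ?scale1r // subr_eq0 eq_sym.
by rewrite xE'; apply: (subspaceZ hK).
Qed.

(** * The induced module lies in the category *)

Section Vhat.
Variables (F : numFieldType) (k : F) (V : vosa F) (gen : gl11 -> V).
Variables (p : bool) (n e : F) (W : vmodule V) (j : verma_space F p -> W).
Hypothesis hk : k != 0.
Hypothesis he : forall z : int, e + z%:~R * k != 0.
Hypothesis hV : is_affine_vosa k gen.
Hypothesis hI : is_induced k (@verma_act F p n e) (@aff_act F V gen W) j.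

Local Notation act := (@aff_act F V gen W).
Local Notation nu := (n + 2%:R^-1).

Definition Vhat_top : W := j (1, 0).
Local Notation w := Vhat_top.

Let hM : is_affine_module k act. Proof. by case: hI. Qed.
Let aL a r := affine_lin a r hM.
Let jlin : is_linear j. Proof. by case: hI => _ []. Qed.
Let j0 a u : act a 0 (j u) = j (verma_act n e a u). Proof. by case: hI => _ []. Qed.

Lemma Vhat_top_homog : homog p w.
Proof.
have [_ [_ jp _ _] _] := hI; apply: (jp p (1, 0)).
by rewrite /= /verma_homog eqxx.
Qed.

Lemma Vhat_top_basis u : j u = u.1 *: w + u.2 *: act psi_m 0 w.
Proof.
rewrite j0 -(linZ jlin) -(linZ jlin) -(linD jlin); congr j; case: u => a b.
by congr pair => /=; rewrite /GRing.scale /= ?mulr0 ?mulr1 ?addr0 ?add0r.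
Qed.

Lemma Vhat_top_hw : is_hw act nu e w.
Proof.
split => [|||a r r0]; last by case: hI => _ [_ _ _ h] _; apply: h.
- rewrite j0 -(linZ jlin); congr j; congr pair; by rewrite /= ?mulr0 // /GRing.scale /= mulr0.
- rewrite j0 -(linZ jlin); congr j; congr pair; by rewrite /= ?mulr0 // /GRing.scale /= mulr0.
- by rewrite j0 -(lin0 jlin); congr j; congr pair; rewrite /= mulr0.
Qed.

Lemma Vhat_generated (S : W -> Prop) : subspace S ->
  (forall a r x, S x -> S (act a r x)) -> S w -> forall x, S x.
Proof.
move=> hS hact Sw; apply: (induced_generated hI hS hact) => u.
rewrite Vhat_top_basis; apply: (subspaceD hS); apply: (subspaceZ hS) => //.
exact: hact.
Qed.

Lemma Vhat_E0 x : act gE 0 x = e *: x.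
Proof.
move: x; apply: (Vhat_generated (S := fun x => act gE 0 x = e *: x)).
- exact: (eigenvector_subspace e (aL gE 0)).
- by move=> a r x hx; rewrite (E0_central hM) hx (linZ (aL _ _)).
- by case: Vhat_top_hw.
Qed.

Lemma Vhat_N0 : semisimple_op (act gN 0).
Proof.
have hS : subspace (family_sum (eigenvector (act gN 0))).
  by apply: family_sum_subspace => h; apply: eigenvector_subspace.
apply: Vhat_generated => // [a r x|].
  apply: (family_sum_ind (Q := fun x => family_sum (eigenvector (act gN 0)) (act a r x))) => [|h y hy].
    split; first by rewrite (lin0 (aL _ _)); apply: hS.1.
    by move=> c y z hy hz; rewrite aL; apply: hS.2.
  apply: (@family_sum1 _ _ _ _ (h + gl_br F gN a a)).
  by rewrite /eigenvector (N0_weight hM) hy (linZ (aL _ _)) scalerDl.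
by apply: (@family_sum1 _ _ _ _ nu); case: Vhat_top_hw.
Qed.

(** Filtration by conformal degree above the top. Its base is the whole image of [j], which all zero
    modes preserve. *)
Let level := filt act (fun _ r => - r) (fun x => exists u, x = j u).

Lemma level_closed f a r x : level f x -> level (f - r) (act a r x).
Proof.
move=> h; apply: (filt_closed hM _ _ _ _ h a r).
- by move=> b c d s t _; rewrite opprD.
- by move=> b c s _; rewrite opprK addNr.
- by move=> b s y s0 [u ->]; case: hI => _ [_ _ _ h0] _; apply: h0; lia.
- by move=> b s y s0 [u ->]; have -> : s = 0 by [lia]; exists (verma_act n e b u).
Qed.

Local Notation L0 := (@mod_L0 F V W).

Let L0_lin : is_linear L0.
Proof. exact: (field_lin (mod_fields W)). Qed.

Lemma level_eigen_subspace f h : subspace (fun y => level f y /\ L0 y = h *: y).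
Proof.
split; first by split; [apply: filt_0|rewrite (lin0 L0_lin) scaler0].
move=> a x y [hx hx'] [hy hy']; split; first exact: filt_lin.
by rewrite L0_lin hx' hy' scalerDr !scalerA mulrC.
Qed.

(** A mode a_r lowers both the filtration degree and the L_0-eigenvalue by r. The degree bounds the
    dimension and the eigenvalue separates the pieces, so recording both confines a generalized
    eigenspace to one finite-dimensional level. *)
Lemma Vhat_levels : exists Delta : F, forall x,
  family_sum (fun (i : nat) y => level i%:Z y /\ L0 y = (Delta + i%:R) *: y) x.
Proof.
have [Delta hD] := L0_hw hV (mod_fields W) (@mod_jacobi F V W) (@mod_vacuum F V W) Vhat_top_hw.
have L0c a r x : L0 (act a r x) = act a r (L0 x) - r%:~R *: act a r x.
  exact: (L0_commutator hV hk (mod_fields W) (@mod_jacobi F V W) (@mod_derivative F V W)).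
exists Delta; set P := (X in family_sum X).
have hS : subspace (family_sum P).
  by apply: family_sum_subspace => i; apply: level_eigen_subspace.
apply: Vhat_generated => // [a r x|].
  apply: (family_sum_ind (Q := fun x => family_sum P (act a r x))) => [|i y [hy hL]].
    split; first by rewrite (lin0 (aL _ _)); apply: hS.1.
    by move=> c y z hy hz; rewrite aL; apply: hS.2.
  have hl := level_closed a r hy.
  have [ir|ir] := ltP (i%:Z - r) 0.
    by rewrite (filt_lt0 hM hl ir); apply: hS.1.
  apply: (@family_sum1 _ _ _ _ `|i%:Z - r|%N).
  have iE : `|i%:Z - r|%N%:Z = i%:Z - r by lia.
  split; first by rewrite iE.
  rewrite L0c hL (linZ (aL _ _)) -scalerBl -addrA; congr (_ *: _); congr (_ + _).
  by rewrite [RHS]pmulrn iE rmorphB.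
apply: (@family_sum1 _ _ _ _ 0); split; last by rewrite addr0.
by apply: filt_base => //; exists (1, 0).
Qed.

Lemma Vhat_grading : grading_restricted W.
Proof.
have [Delta hD] := Vhat_levels.
pose P (i : nat) (y : W) := level i%:Z y /\ L0 y = (Delta + i%:R) *: y.
have hP i : subspace (P i) by apply: level_eigen_subspace.
have none h : (forall i : nat, Delta + i%:R <> h) ->
    forall x, gen_eigenvector L0 h x -> x = 0.
  move=> hn x; apply: (gen_eigenvector_family (mu := fun i : nat => Delta + i%:R)
     (K := fun x => x = 0) L0_lin hP) => //.
  - by move=> i y [].
  - by split => // a y z -> ->; rewrite scaler0 addr0.
  - by move=> y ->; rewrite (lin0 L0_lin) scaler0.
  - by move=> i y _ /hn.
split.
- move=> x; have [s [hs ->]] := hD x.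
  exists [seq (Delta + u.1%:R, u.2) | u <- s]; split; last by rewrite big_map.
  move=> u /(@List.in_map_iff _ _ _ _ _)[v [<- /hs [_ hv]]].
  by exists 1%N; rewrite /= hv subrr.
- move=> h; case: (EM (exists i : nat, Delta + i%:R = h)) => [[i hi]|hn]; last first.
    exists [::] => x /none -> => [|i hi]; last by apply: hn; exists i.
    by exists (fun=> 0); rewrite big_ord0.
  have top_span x : (exists u, x = j u) -> spans [:: w; act psi_m 0 w] x.
    move=> [u ->] S hS hs; rewrite Vhat_top_basis.
    by apply: (subspaceD hS); apply: (subspaceZ hS); [apply: (hs 0%N)|apply: (hs 1%N)].
  have [s hs] := level_finite hM top_span i.
  apply: (@spans_finite_dim _ _ _ s) => x hx; apply: (hs i) => //.
  suff [] : level i x /\ L0 x = h *: x by [].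
  apply: (gen_eigenvector_family (mu := fun i : nat => Delta + i%:R)
     (K := fun x => level i x /\ L0 x = h *: x) L0_lin hP) (hD x) hx => //.
  + by move=> i' y [].
  + by have := hP i; rewrite /P hi.
  + by move=> y [].
  + move=> i' y [hy hL] i'h; split; last by rewrite hL i'h.
    suff -> : i = i' by [].
    by move: i'h; rewrite -hi => /addrI/eqP; rewrite eqr_nat => /eqP.
- move=> h; case: (EM (exists i : nat, Delta + i%:R = h)) => [[i hi]|hn]; last first.
    exists 0%N => m _; apply: none => i hi; apply: hn; exists (i + m)%N.
    by rewrite natrD addrA hi subrK.
  exists i.+1 => m im; apply: none => i' hi'; suff : i = (i' + m)%N by lia.
  apply/eqP; rewrite -(eqr_nat F) natrD; apply/eqP.
  by apply: (@addrI _ Delta); rewrite addrA hi' hi subrK.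
Qed.

Lemma Vhat_finite_length : finite_length W.
Proof.
have sub0 : @is_submodule F V W (fun x => x = 0).
  split => // [a x y -> ->|y z hy hz yz|v m x ->]; first by rewrite scaler0 addr0.
    have H0 q : homog q (0 : W) by apply: (homog_subspace W q).1.
    by apply: (homog_split_eq (p := false) hy hz) => //; rewrite addr0.
  exact: (lin0 (field_lin (mod_fields W) _ _)).
(* This case distinction avoids constructing a nonzero affine module to which the Verma module maps;
   the zero module has a composition series of length 0. *)
case: (EM (forall x : W, x = 0)) => [W0|Wn0].
  exists 0%N, (fun _ x => x = 0); split => //.
exists 1%N, (fun i x => if i is 0%N then x = 0 else True); split => //.
  by move=> [|i] _ //; split.
move=> [|//] _; split => //.
  by apply: contrapT => h; apply: Wn0 => x; apply: contrapT => x0; apply: h; exists x.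
move=> T [T0 Tlin _ Tact] _ _.
case: (EM (exists2 x, T x & x <> 0)) => [hx|nx]; [right|left].
  move=> x; split => // _.
  have hT : subspace T by split.
  apply: Vhat_generated => // [a r y|]; first exact: Tact.
  apply: (fock_irreducible hM Vhat_E0 hk he Vhat_top_hw hI _ hT _ hx).
    (* psi^-_0 has weight 1, so the image of [j] lies in degree 1. *)
    move=> u; exists 1; rewrite Vhat_top_basis.
    have S := filt_subspace act fock_wt (fun x : W => exists c : F, x = c *: w) 1.
    have hw1 : exists c : F, w = c *: w by exists 1; rewrite scale1r.
    apply: (subspaceD S); apply: (subspaceZ S); first exact: filt_base.
    by apply: (@filt_act _ _ _ _ _ 0) => //; apply: filt_base.
  by move=> a r y; apply: Tact.
move=> x; split => [Tx|-> //].
by apply: contrapT => x0; apply: nx; exists x.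
Qed.

Lemma Vhat_in_Ofin : in_Ofin gen W.
Proof.
split; [exact: Vhat_finite_length|exact: Vhat_grading|exact: Vhat_N0|].
by move=> x; exists [:: (e, x)]; split => [u [<-|//]|]; [apply: Vhat_E0|rewrite big_seq1].
Qed.

End Vhat.

(** * Maps out of the induced module *)

Section ParityShift.
Variables (F : numFieldType) (M : superspace F) (q : bool).

Definition shift_homog (r : bool) (x : M) : Prop := homog (q (+) r) x.

Lemma shift_homog_lin r (a : F) x y :
  shift_homog r x -> shift_homog r y -> shift_homog r (a *: x + y).
Proof. exact: homog_lin. Qed.

Lemma shift_homog_direct x : shift_homog false x -> shift_homog true x -> x = 0.
Proof. by rewrite /shift_homog; case: q => h1 h2; apply: homog_direct. Qed.

Lemma shift_homog_sum x :
  exists y z, [/\ shift_homog false y, shift_homog true z & x = y + z].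
Proof.
have [y [z [hy hz ->]]] := homog_split q x; exists y, z; split => //.
  by rewrite /shift_homog addbF.
by rewrite /shift_homog addbT.
Qed.

Definition shift_space : superspace F :=
  Superspace shift_homog_lin shift_homog_direct shift_homog_sum.

Variables (k : F) (act : gl11 -> int -> M -> M).
Hypothesis hM : is_affine_module k act.

Let s a : F := (-1) ^+ (q && gl_par a).

(** With this sign an even affine map into the shifted module is the same as a map of parity [q]
    into M that obeys the sign rule of [homog_morphism]. *)
Definition shift_act a r (x : shift_space) : shift_space := s a *: act a r x.

Lemma shift_affine : is_affine_module k shift_act.
Proof.
split=> [a r c x y|a r t x hx|a b r t x].
- by rewrite /shift_act (affine_lin _ _ hM) scalerDr !scalerA mulrC.
- rewrite /= /shift_homog /shift_act.
  apply: (subspaceZ (homog_subspace M _)).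
  by have := affine_par a r hM hx; rewrite addbCA.
set c := gl_par a && gl_par b.
have E : shift_act a r (shift_act b t x) - (-1) ^+ c *: shift_act b t (shift_act a r x)
    = (s a * s b) *: (gl_comb (gl_br F a b) (fun c => act c (r + t) x)
       + (r%:~R * gl_kappa F a b * (r + t == 0)%:R * k) *: x).
  rewrite /shift_act !(linZ (affine_lin _ _ hM)) (@affine_swap F k M act a b r t x hM).
  rewrite !scalerDr !scalerA addrAC [X in _ - X *: _ + _](_ : _ = s a * s b * (-1) ^+ c).
    by rewrite subrr add0r !mulrA.
  by ring.
have gl_combZ d f : d *: gl_comb (gl_br F a b) f = gl_comb (gl_br F a b) (fun c => d *: f c :> M).
  by rewrite /gl_comb !scalerDr !scalerA ![d * _]mulrC.
rewrite E scalerDr gl_combZ scalerA; congr (_ + _ *: _).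
  (* The signs are multiplicative along nonzero brackets. In the central term, kappa pairs only
     equal parities, where the product of the signs is 1. *)
  apply: eq_gl_comb => d hd; rewrite /shift_act; congr (_ *: _); rewrite /s.
  move: hd; case: (q); case: (a) (b) d => [] [] [] //=; rewrite ?eqxx //= => _;
    by rewrite ?expr0 ?expr1 ?mulrNN ?mulr1 ?mul1r.
suff [-> | ->] : gl_kappa F a b = 0 \/ s a * s b = 1; rewrite ?mulr0 ?mul0r ?mulr0 ?mul1r //.
rewrite /s; case: (q); case: (a) (b) => [] [] /=; rewrite ?expr0 ?expr1 ?mulrNN ?mulr1;
  by [left|right].
Qed.

End ParityShift.

Section Lift.
Variables (F : numFieldType) (k : F) (p : bool) (n e : F) (W M : superspace F).
Variables (act : gl11 -> int -> W -> W) (j : verma_space F p -> W).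
Variables (actM : gl11 -> int -> M -> M).
Hypothesis hI : is_induced k (@verma_act F p n e) act j.
Hypothesis hM : is_affine_module k actM.

(* An odd map out of the induced module is an even map to the parity shift. *)
Lemma induced_lift (q : bool) (y : M) :
  is_hw actM (n + 2%:R^-1) e y -> homog (q (+) p) y ->
  exists g : W -> M, [/\ is_linear g, has_parity q g,
    forall a r x, g (act a r x) = (-1) ^+ (q && gl_par a) *: actM a r (g x)
    & g (j (1, 0)) = y].
Proof.
move=> [hN hE hp hr] hy.
have hX := shift_affine q hM.
pose s a : F := (-1) ^+ (q && gl_par a).
have s2 a : s a * s a = 1 by rewrite /s -expr2 sqrr_sign.
have lin a r := affine_lin a r hM.
have hNm : actM gN 0 (actM psi_m 0 y) = (n - 2%:R^-1) *: actM psi_m 0 y.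
  rewrite (N0_weight hM) hN (linZ (lin _ _)) -scalerDl /=; congr (_ *: _); by field.
have hEm : actM gE 0 (actM psi_m 0 y) = e *: actM psi_m 0 y.
  by rewrite (E0_central hM) hE (linZ (lin _ _)).
have hpm : actM psi_p 0 (actM psi_m 0 y) = e *: y.
  rewrite (mode_swap0 (k := k)) //=; last by right; right.
  by rewrite hp (lin0 (lin _ _)) scaler0 add0r /gl_comb /= !scale0r scale1r !addr0 add0r hE.
have hmm : actM psi_m 0 (actM psi_m 0 y) = 0.
  have := psi_m_psi_m hM 0 0 y; move/eqP; rewrite -addr_eq0 -mulr2n -scaler_nat.
  by rewrite scaler_eq0 pnatr_eq0 => /eqP.
have hrm a r : 0 < r -> actM a r (actM psi_m 0 y) = 0.
  move=> r0; rewrite (mode_swap0 (k := k)) //; last by right; left; lia.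
  rewrite hr // (lin0 (lin _ _)) scaler0 add0r gl_comb0 // => d _.
  by rewrite hr //; lia.
(* In the shifted module psi^-_0 carries the sign [s psi_m], which therefore enters the second
   coordinate. *)
pose phi (u : verma_space F p) : shift_space M q :=
  u.1 *: (y : M) + u.2 *: (s psi_m *: actM psi_m 0 y).
have hphi : is_top_map (@verma_act F p n e) (shift_act (q := q) actM) phi.
  split=> [c u v|r u hu|a u|a r u r0].
  - have e1 : (c *: u + v).1 = c * u.1 + v.1 by [].
    have e2 : (c *: u + v).2 = c * u.2 + v.2 by [].
    by rewrite /phi e1 e2 scalerDr !scalerDl addrACA !scalerA.
  - rewrite /= /shift_homog.
    move: hu; rewrite /= /verma_homog /phi; case: eqP => [-> -> | rp ->].
      by rewrite scale0r addr0; apply: (subspaceZ (homog_subspace M _)).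
    rewrite scale0r add0r.
    do 2!apply: (subspaceZ (homog_subspace M _)).
    have := affine_par psi_m 0 hM hy; rewrite addbCA.
    by case: (r) (p) rp => [] [].
  - rewrite /shift_act /phi -/(s a) (linD (lin _ _)) !(linZ (lin _ _)).
    case: a => /=; rewrite ?hN ?hNm ?hE ?hEm ?hp ?hpm ?hmm.
    + by rewrite /s andbF expr0 scale1r !scalerA mulrC [u.2 * _ * _]mulrC mulrA.
    + by rewrite /s andbF expr0 scale1r !scalerA mulrC [u.2 * _ * _]mulrC mulrA.
    + rewrite !scaler0 add0r scale0r addr0 !scalerA; congr (_ *: _).
      have -> : s psi_p = s psi_m by [].
      by rewrite mulrCA s2 mulr1 mulrC.
    + by rewrite !scaler0 addr0 scale0r add0r !scalerA mulrC.
  - rewrite /shift_act /phi (linD (lin _ _)) !(linZ (lin _ _)) hr // hrm //.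
    by rewrite !scaler0 addr0 scaler0.
have [_ _ univ] := hI.
have [h [[hl hpar ha] hj _]] := univ _ _ phi hX hphi.
exists h; split => //.
by rewrite hj /phi /= scale1r scale0r addr0.
Qed.

Lemma mode_split0 a r q y z : homog q y -> homog (~~ q) z ->
  actM a r (y + z) = 0 -> actM a r y = 0 /\ actM a r z = 0.
Proof.
move=> hy hz; rewrite (linD (affine_lin a r hM)) -[0 in X in X -> _]addr0 => E.
have H0 q' : homog q' (0 : M) by apply: (homog_subspace M q').1.
have h1 := affine_par a r hM hy; have h2 := affine_par a r hM hz.
by apply: homog_split_eq E => //; [exact: h1|rewrite -addbN].
Qed.

Lemma mode_split_eigen a r c q y z : gl_par a = false ->
  homog q y -> homog (~~ q) z ->
  actM a r (y + z) = c *: (y + z) -> actM a r y = c *: y /\ actM a r z = c *: z.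
Proof.
move=> ha hy hz; rewrite (linD (affine_lin a r hM)) scalerDr => E.
have h1 := affine_par a r hM hy; have h2 := affine_par a r hM hz.
rewrite ha !addFb in h1 h2.
by apply: homog_split_eq h1 h2 _ _ E; apply: (subspaceZ (homog_subspace M _)).
Qed.

(** Modes are homogeneous and send the two parity components into different components, so each
    condition holds on each component. *)
Lemma hw_split nu q y z : homog q y -> homog (~~ q) z ->
  is_hw actM nu e (y + z) -> is_hw actM nu e y /\ is_hw actM nu e z.
Proof.
move=> hy hz [hN hE hp hr].
have [N1 N2] := mode_split_eigen (erefl : gl_par gN = false) hy hz hN.
have [E1 E2] := mode_split_eigen (erefl : gl_par gE = false) hy hz hE.
have [P1 P2] := mode_split0 hy hz hp.
by split; split => // a r r0; have [] := mode_split0 hy hz (hr a r r0).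
Qed.

End Lift.

(** * Projectivity *)

Section Modules.
Variables (F : numFieldType) (k : F) (V : vosa F) (gen : gl11 -> V).
Hypothesis hk : k != 0.
Hypothesis hV : is_affine_vosa k gen.
Implicit Types M N : vmodule V.

Lemma vmodule_affine M : is_affine_module k (@aff_act F V gen M).
Proof. exact: (module_affine hV (mod_fields M) (@mod_jacobi F V M) (@mod_vacuum F V M)). Qed.

Lemma vmodule_truncated M (x : M) : exists m : nat,
  forall a (r : int), m%:Z <= r -> aff_act gen a r x = 0.
Proof.
have [_ _ _ h] := mod_fields M.
have [m1 h1] := h (gen gN) x; have [m2 h2] := h (gen gE) x.
have [m3 h3] := h (gen psi_p) x; have [m4 h4] := h (gen psi_m) x.
exists (`|m1| + `|m2| + `|m3| + `|m4|)%N => [[]] r hr; [apply: h1|apply: h2|apply: h3|apply: h4]; lia.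
Qed.

(* a_r lowers the generalized L_0-eigenvalue by r. *)
Lemma vmodule_nilpotent M a r (x : M) : grading_restricted M -> 0 < r ->
  exists m, iter m (aff_act gen a r) x = 0.
Proof.
move=> [hspan _ hlow] r0; set A := aff_act gen a r.
have hA : is_linear A by apply: (affine_lin a r (vmodule_affine M)).
have L0_lin : is_linear (@mod_L0 F V M) by apply: (field_lin (mod_fields M)).
have iterA m : is_linear (iter m A) by elim: m => [|m IH] c y z //=; rewrite IH hA.
have mono m m' y : (m <= m')%N -> iter m A y = 0 -> iter m' A y = 0.
  by move=> /subnK <- h; rewrite iterD h (lin0 (iterA _)).
have L0A y : mod_L0 (A y) = A (mod_L0 y) - r%:~R *: A y.
  exact: (L0_commutator hV hk (mod_fields M) (@mod_jacobi F V M) (@mod_derivative F V M)).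
have genA h y : gen_eigenvector (@mod_L0 F V M) h y ->
    gen_eigenvector (@mod_L0 F V M) (h - r%:~R) (A y).
  move=> [m hm]; exists m.
  have -> : iter m (fun y => mod_L0 y - (h - r%:~R) *: y) (A y)
      = A (iter m (fun y => mod_L0 y - h *: y) y).
    elim: m {hm} => //= m ->; rewrite L0A (linB hA) (linZ hA) scalerBl opprB addrA.
    by rewrite subrK.
  by rewrite hm (lin0 hA).
apply: (family_sum_ind (Q := fun x => exists m, iter m A x = 0)) (hspan x) => [|h y hy].
  split; first by exists 0%N.
  move=> c y z [m1 h1] [m2 h2]; exists (maxn m1 m2).
  by rewrite iterA (mono m1) ?leq_maxl // (mono m2) ?leq_maxr // scaler0 addr0.
have [N hN] := hlow h; exists N; apply: (hN (`|r| * N)%N).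
  by rewrite leq_pmull // absz_gt0; lia.
elim: (N) => [|m IH]; first by rewrite muln0 subr0.
have -> : h - (`|r| * m.+1)%:R = h - (`|r| * m)%:R - r%:~R.
  rewrite mulnS addnC natrD opprD addrA; congr (_ - _).
  by rewrite pmulrn gez0_abs // ltW.
exact: genA.
Qed.

Lemma morphism_lin M N (s : M -> N) : morphism s -> is_linear s.
Proof.
by move=> [s0 [s1 [[l0 _ _] [l1 _ _] sE]]] c x y; rewrite !sE l0 l1 scalerDr addrACA.
Qed.

Lemma homog_morphism_act M N q (s : M -> N) a r x : homog_morphism q s ->
  s (aff_act gen a r x) = (-1) ^+ (q && gl_par a) *: aff_act gen a r (s x).
Proof. by case=> _ _; apply; case: hV => h _ _; apply: h. Qed.

Lemma morphism_even M N (s : M -> N) a r x : morphism s -> gl_par a = false ->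
  s (aff_act gen a r x) = aff_act gen a r (s x).
Proof.
move=> [s0 [s1 [h0 h1 sE]]] ha; rewrite !sE !(homog_morphism_act _ _ _ h0) !(homog_morphism_act _ _ _ h1).
by rewrite ha !andbF expr0 !scale1r (linD (affine_lin a r (vmodule_affine N))).
Qed.

Lemma morphism_zero M N (s : M -> N) a r x : morphism s ->
  aff_act gen a r x = 0 -> aff_act gen a r (s x) = 0.
Proof.
move=> [s0 [s1 [h0 h1 sE]]] hx; have lN := affine_lin a r (vmodule_affine N).
have z q s' : homog_morphism q s' -> aff_act gen a r (s' x) = 0 :> N.
  move=> hs; have [sl _ _] := hs.
  have /eqP := homog_morphism_act a r x hs; rewrite hx (lin0 sl) eq_sym scaler_eq0.
  by rewrite signr_eq0 => /eqP.
by rewrite sE (linD lN) (z _ _ h0) (z _ _ h1) addr0.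
Qed.

(** Odd modes pass the even and the odd part of a morphism with different signs. For two modes of
    equal parity the signs cancel, and every correction term is such a product. *)
Lemma morphism_quadratic M N (s : M -> N) a b r t x : morphism s -> gl_par a = gl_par b ->
  s (aff_act gen b t (aff_act gen a r x)) = aff_act gen b t (aff_act gen a r (s x)).
Proof.
move=> [s0 [s1 [h0 h1 sE]]] hab; rewrite !sE.
have l c m := affine_lin c m (vmodule_affine N).
rewrite !(linD (l _ _)) !(homog_morphism_act _ _ _ h0) !(homog_morphism_act _ _ _ h1) hab.
by rewrite !(linZ (l _ _)) !scalerA -!expr2 !sqrr_sign !scale1r.
Qed.

Lemma morphism_hw M N (f : M -> N) nu e x : morphism f ->
  is_hw (@aff_act F V gen M) nu e x -> is_hw (@aff_act F V gen N) nu e (f x).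
Proof.
move=> hf [hN hE hp hr]; have fl := morphism_lin hf; split.
- by rewrite -morphism_even // hN (linZ fl).
- by rewrite -morphism_even // hE (linZ fl).
- exact: morphism_zero.
- by move=> a r r0; apply: morphism_zero => //; apply: hr.
Qed.

Variables (e : F).
Hypothesis he : forall z : int, e + z%:~R * k != 0.

(** Semisimplicity of E_0 and N_0 provides honest eigenvectors: a polynomial projector normalized at
    the eigenvalue of [z] does not change the image [z]. The E_0-projection precedes [kill_all],
    which relies on E_0 = e. *)
Lemma hw_lift M N (s : M -> N) nu z : in_Ofin gen M -> morphism s ->
  (forall y, exists x, s x = y) -> is_hw (@aff_act F V gen N) nu e z ->
  exists y, s y = z /\ is_hw (@aff_act F V gen M) nu e y.
Proof.
move=> [_ hgr hssN hssE] hs surj [zN zE zp zr]; have [x0 x0z] := surj z.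
have hM := vmodule_affine M; have sl := morphism_lin hs.
have lM a r := affine_lin a r hM; have lN a r := affine_lin a r (vmodule_affine N).
have keep a lam mu x : gl_par a = false -> mu != lam -> s x = z ->
    aff_act gen a 0 z = lam *: z ->
    s ((lam - mu)^-1 *: (aff_act gen a 0 x - mu *: x)) = z.
  move=> ha hmu sx hz; rewrite (linZ sl) (linB sl) (linZ sl) morphism_even // sx hz.
  by rewrite -scalerBl scalerA mulVf ?scale1r // subr_eq0 eq_sym.
have [x1 [x1z x1E]] : exists y, s y = z /\ aff_act gen gE 0 y = e *: y.
  apply: (eigenvector_project (Q := fun y => s y = z)) (lM gE 0) _ (hssE x0) x0z.
  by move=> mu y hmu hy; apply: keep.
pose R x := s x = z /\ aff_act gen gE 0 x = e *: x.
have [|||||x2 [[x2z x2E] x2p x2r]] := @kill_all F k e M _ hM hk he R.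
- by move=> x [].
- move=> a r c x har [sx hx]; split.
    rewrite (linD sl) (linZ sl) morphism_quadratic //; last by case: (a).
    rewrite sx; have -> : aff_act gen a r z = 0 by case: har => [/zr ->|[-> ->]].
    by rewrite (lin0 (lN _ _)) scaler0 addr0.
  rewrite (linD (lM _ _)) (linZ (lM _ _)) !(E0_central hM) hx !(linZ (lM _ _)).
  by rewrite scalerDr !scalerA mulrC.
- exact: vmodule_truncated.
- by move=> a r x _ r0; apply: vmodule_nilpotent.
- by exists x1.
pose Q y := [/\ s y = z, aff_act gen gE 0 y = e *: y, aff_act gen psi_p 0 y = 0
  & forall a r, 0 < r -> aff_act gen a r y = 0].
(* The commutator of N_0 with a_r is a multiple of a_r, so projecting with N_0 keeps every
   annihilation condition. *)
have NS a r c (x : M) : aff_act gen a r x = 0 ->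
    aff_act gen a r (aff_act gen gN 0 x - c *: x) = 0.
  move=> h; have := N0_weight hM a r x; rewrite h (lin0 (lM _ _)) scaler0 addr0 => h'.
  by rewrite (linB (lM _ _)) (linZ (lM _ _)) h scaler0 subr0 -h'.
have [y [[yz yE yp yr] yN]] : exists y, Q y /\ aff_act gen gN 0 y = nu *: y.
  apply: (eigenvector_project (Q := Q)) (lM gN 0) _ (hssN x2) _ => // mu y hmu [yz yE yp yr].
  split; first exact: keep.
  - have S := eigenvector_subspace e (lM gE 0).
    apply: (subspaceZ S); apply: (subspaceB S); last exact: (subspaceZ S).
    by rewrite /eigenvector (E0_central hM) yE (linZ (lM _ _)).
  - by rewrite (linZ (lM _ _)) NS // scaler0.
  - by move=> a r r0; rewrite (linZ (lM _ _)) NS ?scaler0 // yr.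
by exists y.
Qed.

Lemma Vhat_projective (p : bool) (n : F) (W : vmodule V) :
  is_Vhat k gen p n e W -> projective_in_Ofin gen W.
Proof.
move=> [j hI]; split; first exact: (Vhat_in_Ofin hk he hV hI).
move=> M N hMO _ s f hs surj hf.
have hM := vmodule_affine M.
pose w := Vhat_top j.
have [y [yz yhw]] := hw_lift hMO hs surj (morphism_hw hf (Vhat_top_hw hI)).
(* The lift [y] may mix parities: its component in the parity of [w] extends to an even map, the
   other one to an odd map. *)
have [y0 [y1 [hy0 hy1 yE]]] := homog_split p y.
rewrite yE in yhw; have [hw0 hw1] := hw_split hM hy0 hy1 yhw.
have [g0 [g0l g0p g0a g0w]] := @induced_lift F k p n e _ _ _ j _ hI hM false y0 hw0 hy0.
have [g1 [g1l g1p g1a g1w]] := @induced_lift F k p n e _ _ _ j _ hI hM true y1 hw1 hy1.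
have hg0 := homog_morphism_of_affine hV g0l g0p g0a.
have hg1 := homog_morphism_of_affine hV g1l g1p g1a.
exists (fun x => g0 x + g1 x); first by exists g0, g1.
have [s0 [s1 [hs0 hs1 sE]]] := hs; have [f0 [f1 [hf0 hf1 fE]]] := hf.
have [[s0l s0p _] [s1l s1p _]] := (hs0, hs1).
have [[f0l f0p _] [f1l f1p _]] := (hf0, hf1).
(* The even and the odd parts of the equation are checked separately: within each part all terms
   pick up the same sign at an odd mode, so the solutions form a submodule and it suffices to check
   [w]. *)
suff H x : s0 (g0 x) + s1 (g1 x) = f0 x /\ s1 (g0 x) + s0 (g1 x) = f1 x.
  move=> x; have [E0 E1] := H x; rewrite sE fE -E0 -E1 (linD s0l) (linD s1l).
  by rewrite [s1 _ + s1 _]addrC addrACA [s0 (g1 x) + _]addrC.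
move: x; apply: (Vhat_generated hI).
- split; first by rewrite !(lin0 g0l, lin0 g1l, lin0 s0l, lin0 s1l, lin0 f0l, lin0 f1l) addr0.
  move=> a x x' [E0 E1] [E0' E1'].
  rewrite f0l f1l -E0 -E1 -E0' -E1' g0l g1l !s0l !s1l.
  by split; rewrite scalerDr addrACA.
- move=> a r x [E0 E1]; have lN := affine_lin a r (vmodule_affine N).
  rewrite !(homog_morphism_act a r _ hg0) !(homog_morphism_act a r _ hg1).
  rewrite !(linZ s0l) !(linZ s1l) !(homog_morphism_act a r _ hs0) !(homog_morphism_act a r _ hs1).
  rewrite !(homog_morphism_act a r _ hf0) !(homog_morphism_act a r _ hf1).
  rewrite !scalerA /= expr0 !mul1r !mulr1 -!expr2 sqrr_sign !scale1r -E0 -E1.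
  by rewrite !(linD lN) scalerDr.
have hwp : homog p w by apply: (Vhat_top_homog hI).
move: yz; rewrite yE sE fE (linD s0l) (linD s1l) -!/w => yz.
have {}yz : (s0 y0 + s1 y1) + (s1 y0 + s0 y1) = f0 w + f1 w.
  by rewrite -yz [s1 y0 + s1 y1]addrC [RHS]addrACA [s0 y1 + _]addrC.
have Np := homog_subspace N p; have Nn := homog_subspace N (~~ p).
have g0w' : g0 w = y0 by []. have g1w' : g1 w = y1 by [].
rewrite g0w' g1w'; apply: homog_split_eq yz.
- apply: (subspaceD Np); first exact: (s0p p).
  by have := s1p _ _ hy1; rewrite /= negbK.
- apply: (subspaceD Nn); first exact: (s1p p).
  exact: (s0p (~~ p)).
- exact: (f0p p).
- exact: (f1p p).
Qed.

End Modules.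

Theorem theorem2p4p6 (R : realType) (k : R[i]) (hk : k <> 0)
  (V : vosa R[i]) (gen : gl11 -> V) (hV : is_affine_vosa k gen)
  (n e : R[i]) (he : forall z : int, e / k <> z%:~R)
  (p : bool) (W : vmodule V) (hW : is_Vhat k gen p n e W) :
  projective_in_Ofin gen W.
Proof.
have k0 : k != 0 by apply/eqP.
apply: (Vhat_projective k0 hV _ hW) => z.
apply/eqP => /eqP; rewrite addr_eq0 => /eqP ez; apply: (he (- z)).
by rewrite ez mulNr mulfK // rmorphN.
Qed.
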